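(* Let $1/4<\alpha<1/3$, let $\mathbf X=(X^1,X^2,X^3)$, $\tilde{\mathbf X}=(\tilde X^1,\tilde X^2,\tilde X^3)\in\Omega_\alpha(\mathcal V)$ be two level-3 $\alpha$-Hölder rough paths over a Euclidean space $\mathcal V$ on $[0,T]$, and let $(Y,Y^\dagger,Y^{\dagger\dagger})\in\mathcal Q^\alpha_{\mathbf X}([0,T],\mathcal W)$, $(\tilde Y,\tilde Y^\dagger,\tilde Y^{\dagger\dagger})\in\mathcal Q^\alpha_{\tilde{\mathbf X}}([0,T],\mathcal W)$ be controlled rough paths lying in a bounded set, that is, for some $M<\infty$, $$|Y_0|+|Y^\dagger_0|+|Y^{\dagger\dagger}_0|+\|(Y,Y^\dagger,Y^{\dagger\dagger})\|_{\mathcal Q^\alpha_{\mathbf X},[0,T]}\le M,\qquad |||\mathbf X|||_{\alpha\text{-hld}}\le M,$$ with identical bounds for $\tilde{\mathbf X}$ and $(\tilde Y,\tilde Y^\dagger,\tilde Y^{\dagger\dagger})$. Let $\Phi:\mathcal W\to\mathcal W'$ be of class $C^4$ and define $$(Z,Z^\dagger,Z^{\dagger\dagger}):=\big(\Phi(Y),\ \nabla\Phi(Y)Y^\dagger,\ \nabla\Phi(Y)Y^{\dagger\dagger}+\nabla^2\Phi(Y)\langle Y^\dagger\cdot,Y^\dagger\star\rangle\big)\in\mathcal Q^\alpha_{\mathbf X}([0,T],\mathcal W'),$$ and similarly $(\tilde Z,\tilde Z^\dagger,\tilde Z^{\dagger\dagger})\in\mathcal Q^\alpha_{\tilde{\mathbf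 X}}([0,T],\mathcal W')$. Then one has the local Lipschitz estimates $$d_{\mathbf X,\tilde{\mathbf X},3\alpha}(Z,Z^\dagger,Z^{\dagger\dagger};\tilde Z,\tilde Z^\dagger,\tilde Z^{\dagger\dagger})\le C_M\,R\qquad\text{and}\qquad \|Z-\tilde Z\|_{\alpha\text{-hld}}\le C_M\,R,$$ for a suitable constant $C_M=C(M,\alpha,\Phi)>0$, where $$R=\rho_\alpha(\mathbf X,\tilde{\mathbf X})+|Y_0-\tilde Y_0|+|Y^\dagger_0-\tilde Y^\dagger_0|+|Y^{\dagger\dagger}_0-\tilde Y^{\dagger\dagger}_0|+d_{\mathbf X,\tilde{\mathbf X},3\alpha}(Y,Y^\dagger,Y^{\dagger\dagger};\tilde Y,\tilde Y^\dagger,\tilde Y^{\dagger\dagger}).$$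
   Context: The time horizon $T>0$ is fixed; $\mathcal V,\mathcal W,\mathcal W'$ are Euclidean spaces. $\Delta_T=\{0\le s\le t\le T\}$; $\|\varphi\|_{\eta\text{-hld}}=\sup_{s<t}|\varphi_t-\varphi_s|/(t-s)^\eta$ for paths and $\|\psi\|_{\eta\text{-hld}}=\sup_{s<t}|\psi_{s,t}|/(t-s)^\eta$ for maps on $\Delta_T$. A level-3 rough path $\mathbf X=(X^1,X^2,X^3)\in\Omega_\alpha(\mathcal V)$ is a continuous map from $\Delta_T$ to $\mathcal V\oplus\mathcal V^{\otimes2}\oplus\mathcal V^{\otimes3}$ with $(1,\mathbf X_{s,t})=(1,\mathbf X_{s,u})\otimes(1,\mathbf X_{u,t})$ for $s\le u\le t$ in the truncated tensor algebra and $|||\mathbf X|||_{\alpha\text{-hld}}:=\sum_{i=1}^3\|X^i\|_{i\alpha\text{-hld}}<\infty$; $\rho_\alpha(\mathbf X,\tilde{\mathbf X})=\sum_{i=1}^3\|X^i-\tilde X^i\|_{i\alpha\text{-hld}}$. $(Y,Y^\dagger,Y^{\dagger\dagger})\in\mathcal Q^\alpha_{\mathbf X}([0,T],\mathcal W)$ (controlled rough path) means: $Y,Y^\dagger,Y^{\dagger\dagger}$ are $\alpha$-Hölder paths in $\mathcal W$, $L(\mathcal V,\mathcal W)$, $L(\mathcal V,L(\mathcal V,\mathcal W))\cong L(\mathcal V^{\otimes2},\mathcal W)$, and the remainders defined by $Y_t-Y_s=Y^\dagger_sX^1_{s,t}+Y^{\dagger\dagger}_sX^2_{s,t}+Y^\sharp_{s,t}$,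 $Y^\dagger_t-Y^\dagger_s=Y^{\dagger\dagger}_sX^1_{s,t}+Y^{\sharp\sharp}_{s,t}$ satisfy $\|Y^\sharp\|_{3\alpha\text{-hld}}<\infty$, $\|Y^{\sharp\sharp}\|_{2\alpha\text{-hld}}<\infty$. The seminorm is $\|(Y,Y^\dagger,Y^{\dagger\dagger})\|_{\mathcal Q^\alpha_{\mathbf X},[0,T]}=\|Y^{\dagger\dagger}\|_{\alpha\text{-hld}}+\|Y^\sharp\|_{3\alpha\text{-hld}}+\|Y^{\sharp\sharp}\|_{2\alpha\text{-hld}}$, and the distance is $d_{\mathbf X,\tilde{\mathbf X},3\alpha}(Y,Y^\dagger,Y^{\dagger\dagger};\tilde Y,\tilde Y^\dagger,\tilde Y^{\dagger\dagger})=\|Y^{\dagger\dagger}-\tilde Y^{\dagger\dagger}\|_{\alpha\text{-hld}}+\|Y^\sharp-\tilde Y^\sharp\|_{3\alpha\text{-hld}}+\|Y^{\sharp\sharp}-\tilde Y^{\sharp\sharp}\|_{2\alpha\text{-hld}}$. In $\nabla^2\Phi(Y)\langle Y^\dagger\cdot,Y^\dagger\star\rangle$ the symbols $\cdot,\star$ stand for the two arguments in $\mathcal V$.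
   Formalization: For Z, Z̃ being controlled and for the first estimate, X and X̃ are also assumed to satisfy Sym(X²)=½X¹⊗X¹ (level-2 geometricity); without it these fail, e.g. X=(0,t^{2α}−s^{2α},0), Y=(0,1,0), Φ(y)=y². The second estimate needs no such assumption. *)

(* Defs.v *)
From HB Require Import structures.
From mathcomp Require Import all_boot all_order all_algebra.
From mathcomp Require Import all_classical all_reals all_analysis.
Export numFieldNormedType.Exports.

Set Implicit Arguments.
Unset Strict Implicit.
Unset Printing Implicit Defensive.

Import Order.TTheory GRing.Theory Num.Theory.
Local Open Scope classical_set_scope.
Local Open Scope ring_scope.

(* The Euclidean spaces are R^d, realized as ['rV[R]_d].  The other spaces
   are represented by the coordinates in the standard bases (e_i):
   - V (x) V : ['M[R]_d], with entry (i, j) the coefficient of e_i (x) e_j;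
   - L(V, W) : ['M[R]_(d, e)], with row i the image of e_i, so that v is
     mapped to [v *m A];
   - L(V, L(V, W)) : [cube R d e], with component i in L(V, W) the image of
     e_i; as an element of L(V (x) V, W) it maps e_i (x) e_j to
     [row j (A i)], i.e., A (v (x) w) = (A v) w;
   - V (x) V (x) V : [cube R d d], with [A i j k] the coefficient of
     e_i (x) e_j (x) e_k. *)

Definition cube (R : realType) (d e : nat) := {ffun 'I_d -> 'M[R]_(d, e)}.

(* The library norm [`|A|] on matrices is the sup norm, hence the following
   Euclidean (Hilbert-Schmidt) norms. *)
Definition enorm (R : realType) (m n : nat) (A : 'M[R]_(m, n)) : R :=
  Num.sqrt (\sum_i \sum_j A i j ^+ 2).

Definition cnorm (R : realType) (d e : nat) (A : cube R d e) : R :=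
  Num.sqrt (\sum_i \sum_j \sum_k A i j k ^+ 2).

Definition cube_app1 (R : realType) (d e : nat) (A : cube R d e)
    (v : 'rV[R]_d) : 'M[R]_(d, e) :=
  \sum_i v 0 i *: A i.

Definition cube_app2 (R : realType) (d e : nat) (A : cube R d e)
    (x : 'M[R]_d) : 'rV[R]_e :=
  \sum_i \sum_j x i j *: row j (A i).

(* The Hoelder seminorms below take values in [\bar R], and are infinite when
   the supremum is.  Paths on [0, T] and maps on the simplex are total
   functions of real arguments; only their values on [0, T] and on the simplex
   matter.  [N] is the norm of the target space. *)

Definition simplex (R : realType) (T : R) : set (R * R) :=
  [set p | 0 <= p.1 /\ p.1 <= p.2 /\ p.2 <= T].

Definition hld2 (R : realType) (U : Type) (N : U -> R) (T eta : R)
    (psi : R -> R -> U) : \bar R :=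
  ereal_sup [set (N (psi p.1 p.2) / (p.2 - p.1) `^ eta)%:E
            | p in [set p : R * R | 0 <= p.1 /\ p.1 < p.2 /\ p.2 <= T]].

Definition hld1 (R : realType) (U : zmodType) (N : U -> R) (T eta : R)
    (phi : R -> U) : \bar R :=
  hld2 N T eta (fun s t => phi t - phi s).

Record rpath (R : realType) (d : nat) := RPath {
  lvl1 : R -> R -> 'rV[R]_d;
  lvl2 : R -> R -> 'M[R]_d;
  lvl3 : R -> R -> cube R d d }.

Section RoughPaths.
Local Open Scope ereal_scope.

Definition rp_norm (R : realType) (d : nat) (T alpha : R) (X : rpath R d)
    : \bar R :=
  hld2 (@enorm R 1 d) T alpha (lvl1 X)
  + hld2 (@enorm R d d) T (2 * alpha)%R (lvl2 X)
  + hld2 (@cnorm R d d) T (3 * alpha)%R (lvl3 X).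

Definition rp_dist (R : realType) (d : nat) (T alpha : R) (X X' : rpath R d)
    : \bar R :=
  hld2 (@enorm R 1 d) T alpha (fun s t => lvl1 X s t - lvl1 X' s t)%R
  + hld2 (@enorm R d d) T (2 * alpha)%R
      (fun s t => lvl2 X s t - lvl2 X' s t)%R
  + hld2 (@cnorm R d d) T (3 * alpha)%R
      (fun s t => lvl3 X s t - lvl3 X' s t)%R.

End RoughPaths.

Definition rp_continuous (R : realType) (d : nat) (T : R) (X : rpath R d) :=
  [/\ {within simplex T, continuous (fun p : R * R => lvl1 X p.1 p.2)},
      {within simplex T, continuous (fun p : R * R => lvl2 X p.1 p.2)} &
      forall i, {within simplex T, continuous
                  (fun p : R * R => lvl3 X p.1 p.2 i)}].

(* (1, X_st) = (1, X_su) (x) (1, X_ut) in the truncated tensor algebra, by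
   degree and coordinate. *)
Definition chen (R : realType) (d : nat) (T : R) (X : rpath R d) :=
  forall s u t : R, 0 <= s -> s <= u -> u <= t -> t <= T ->
  [/\ lvl1 X s t = lvl1 X s u + lvl1 X u t,
      forall i j, lvl2 X s t i j =
        lvl2 X s u i j + lvl1 X s u 0 i * lvl1 X u t 0 j + lvl2 X u t i j &
      forall i j k, lvl3 X s t i j k =
        lvl3 X s u i j k + lvl2 X s u i j * lvl1 X u t 0 k
        + lvl1 X s u 0 i * lvl2 X u t j k + lvl3 X u t i j k].

Definition rough_path (R : realType) (d : nat) (T alpha : R) (X : rpath R d) :=
  [/\ rp_continuous T X, chen T X & (rp_norm T alpha X < +oo)%E].

(* The symmetric part of X^2 is (X^1 (x) X^1) / 2: the level-2 part of weak
   geometricity.  It does not follow from [rough_path], and without it Phi(Y)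
   need not be controlled by X: for d = 1, X^1 = 0, X^2_st = t^2alpha - s^2alpha,
   X^3 = 0, Y = 0, Y^dag = 1, Y^dagdag = 0 and Phi(y) = y^2, the remainder
   Z^sharp_st = - 2 X^2_st is not 3alpha-Hoelder. *)
Definition geometric2 (R : realType) (d : nat) (T : R) (X : rpath R d) :=
  forall s t : R, 0 <= s -> s <= t -> t <= T ->
  forall i j, lvl2 X s t i j + lvl2 X s t j i = lvl1 X s t 0 i * lvl1 X s t 0 j.

Record cpath (R : realType) (d e : nat) := CPath {
  cp0 : R -> 'rV[R]_e;
  cp1 : R -> 'M[R]_(d, e);
  cp2 : R -> cube R d e }.

(* Y^sharp *)
Definition rem0 (R : realType) (d e : nat) (X : rpath R d) (Y : cpath R d e)
    (s t : R) : 'rV[R]_e :=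
  cp0 Y t - cp0 Y s - lvl1 X s t *m cp1 Y s - cube_app2 (cp2 Y s) (lvl2 X s t).

(* Y^sharpsharp *)
Definition rem1 (R : realType) (d e : nat) (X : rpath R d) (Y : cpath R d e)
    (s t : R) : 'M[R]_(d, e) :=
  cp1 Y t - cp1 Y s - cube_app1 (cp2 Y s) (lvl1 X s t).

Section Controlled.
Local Open Scope ereal_scope.

Definition controlled (R : realType) (d e : nat) (T alpha : R) (X : rpath R d)
    (Y : cpath R d e) : Prop :=
  [/\ hld1 (@enorm R 1 e) T alpha (cp0 Y) < +oo,
      hld1 (@enorm R d e) T alpha (cp1 Y) < +oo,
      hld1 (@cnorm R d e) T alpha (cp2 Y) < +oo,
      hld2 (@enorm R 1 e) T (3 * alpha)%R (rem0 X Y) < +oo &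
      hld2 (@enorm R d e) T (2 * alpha)%R (rem1 X Y) < +oo].

Definition cp_norm (R : realType) (d e : nat) (T alpha : R) (X : rpath R d)
    (Y : cpath R d e) : \bar R :=
  hld1 (@cnorm R d e) T alpha (cp2 Y)
  + hld2 (@enorm R 1 e) T (3 * alpha)%R (rem0 X Y)
  + hld2 (@enorm R d e) T (2 * alpha)%R (rem1 X Y).

Definition cp_dist (R : realType) (d e : nat) (T alpha : R)
    (X X' : rpath R d) (Y Y' : cpath R d e) : \bar R :=
  hld1 (@cnorm R d e) T alpha (fun t => cp2 Y t - cp2 Y' t)%R
  + hld2 (@enorm R 1 e) T (3 * alpha)%R
      (fun s t => rem0 X Y s t - rem0 X' Y' s t)%R
  + hld2 (@enorm R d e) T (2 * alpha)%R
      (fun s t => rem1 X Y s t - rem1 X' Y' s t)%R.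

End Controlled.

(* In finite dimension, the derivative x |-> 'd f x is of class C^k (as a map
   to linear maps) iff all its evaluations x |-> 'd f x v are. *)
Fixpoint classC (R : realType) (m n : nat) (k : nat)
    (f : 'rV[R]_m -> 'rV[R]_n) : Prop :=
  if k is k'.+1 then
    (forall x, differentiable f x) /\
    (forall v, classC k' (fun x => 'd f x v))
  else continuous f.

Definition hessian (R : realType) (m n : nat) (f : 'rV[R]_m -> 'rV[R]_n)
    (x v w : 'rV[R]_m) : 'rV[R]_n :=
  'd (fun y => 'd f y w) x v.

Definition cp_comp (R : realType) (d e e' : nat)
    (Phi : 'rV[R]_e -> 'rV[R]_e') (Y : cpath R d e) : cpath R d e' :=
  CPath
    (fun t => Phi (cp0 Y t))
    (fun t => \matrix_(i < d) 'd Phi (cp0 Y t) (row i (cp1 Y t)))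
    (fun t => [ffun i => \matrix_(j < d)
       ('d Phi (cp0 Y t) (row j (cp2 Y t i))
        + hessian Phi (cp0 Y t) (row i (cp1 Y t)) (row j (cp1 Y t)))]).

(* Main.v *)
From HB Require Import structures.
Require Import Defs.
From mathcomp Require Import all_boot all_order all_algebra.
From mathcomp Require Import all_classical all_reals all_analysis.
From mathcomp Require Import ring lra.

(** All estimates are uniform over a family of pairs of controlled rough paths
    and over pairs of times s < t.  Call a quantity of order k if its two
    versions are O(tau^k) and differ by O(R tau^k), where tau = (t - s)^alpha;
    these classes are stable under sums and multiply under products.  The data
    say that X^1, X^2 and the increments and remainders of Y have their natural
    orders, whence Y, Y^dag, Y^dagdag have order 0.  By the mean value theorem
    in an auxiliary parameter, the Taylor remainders of Phi at Y_s have orders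
    1, 2 and 3, and Z^sharp and Z^sharpsharp become finite sums of products of
    total order 3 and 2.  In Z^sharp the term X^2 against nabla^2 Phi cancels
    half of nabla^2 Phi on (X^1, X^1), because nabla^2 Phi is symmetric and the
    symmetric part of X^2 is half of X^1 (x) X^1. *)

(** An order records size and dependence on the data in one predicate, so each expansion is carried
    out once and yields both the absolute and the Lipschitz bound. Its constant is chosen before the
    index, and the index ranges over all admissible pairs, because the constant of the theorem is
    chosen before the paths. Comparing two versions costs one derivative: a Taylor remainder of
    order k is bounded by derivatives of order k, and its difference by their Lipschitz constants on
    bounded sets. The third-order remainder in Z^sharp is therefore what calls for C^4. Lowering an
    order uses tau <= T^alpha, so the constants depend on T as well. The distance R is an extended
    real; the estimates are made with an arbitrary real upper bound of it, the field [sD] below. *)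

Set Implicit Arguments.
Unset Strict Implicit.
Unset Printing Implicit Defensive.

Import Order.TTheory GRing.Theory Num.Theory.
Local Open Scope classical_set_scope.
Local Open Scope ring_scope.

(* "f is of order k": [f true] and [f false] are the two versions of a quantity,
   [a] is the small parameter and [D] the distance of the data. *)
Definition bnd (R : realType) (J : Type) (P : J -> Prop) (a D : J -> R)
    (k : nat) (f : bool -> J -> R) : Prop :=
  exists2 K : R, 0 <= K & forall j, P j ->
    (forall b, `|f b j| <= K * a j ^+ k) /\
    `|f true j - f false j| <= K * D j * a j ^+ k.

Definition mbnd (R : realType) (J : Type) (P : J -> Prop) (a D : J -> R)
    (k m n : nat) (F : bool -> J -> 'M[R]_(m, n)) : Prop :=
  forall i l, bnd P a D k (fun b j => F b j i l).

(** The upper bound on [a] is what allows an order to be lowered, in [bnd_weak]. *)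
Definition valid_scale (R : realType) (J : Type) (P : J -> Prop) (a D : J -> R) :=
  (forall j, P j -> 0 <= a j) /\ (forall j, P j -> 0 <= D j) /\
  exists A, forall j, P j -> a j <= A.

(** * Calculus of orders for real quantities *)

Section Bnd.
Context (R : realType) (J : Type) (P : J -> Prop) (a D : J -> R).
Hypothesis Ha : valid_scale P a D.
Implicit Types (f g : bool -> J -> R) (k l : nat).
Local Notation bnd := (bnd P a D).

Let a0 j : P j -> 0 <= a j. Proof. by case: Ha => + _; apply. Qed.
Let D0 j : P j -> 0 <= D j. Proof. by case: Ha => _ [+ _]; apply. Qed.
Let ak k j : P j -> 0 <= a j ^+ k. Proof. by move=> /a0; exact: exprn_ge0. Qed.

Lemma bnd_ext k f g : (forall b j, P j -> f b j = g b j) ->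
  bnd k f -> bnd k g.
Proof.
move=> fg [K K0 HK]; exists K => // j Pj; rewrite -!fg//.
by have [h1 h2] := HK _ Pj; split => // b; rewrite -fg.
Qed.

Lemma bnd_cst c : bnd 0 (fun _ _ => c).
Proof.
exists `|c| => // j Pj; rewrite expr0 mulr1; split => //.
by rewrite subrr normr0 !mulr_ge0// D0.
Qed.

Lemma bndD k f g : bnd k f -> bnd k g -> bnd k (fun b j => f b j + g b j).
Proof.
move=> [K K0 HK] [L L0 HL]; exists (K + L); first exact: addr_ge0.
move=> j Pj; have [hf hfd] := HK _ Pj; have [hg hgd] := HL _ Pj; split=> [b|].
  by rewrite mulrDl (le_trans (ler_normD _ _))// lerD.
rewrite opprD addrACA !mulrDl (le_trans (ler_normD _ _))// lerD//.
Qed.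

Lemma bndN k f : bnd k f -> bnd k (fun b j => - f b j).
Proof.
move=> [K K0 HK]; exists K => // j Pj; have [hf hfd] := HK _ Pj; split=> [b|].
  by rewrite normrN.
by rewrite -opprD normrN.
Qed.

Lemma bndB k f g : bnd k f -> bnd k g -> bnd k (fun b j => f b j - g b j).
Proof. by move=> hf hg; exact: bndD hf (bndN hg). Qed.

(** The difference of the products telescopes as f (g - g') + (f - f') g', with one factor [D] in
    each term; the 2 in the constant counts these terms. *)
Lemma bndM k l f g : bnd k f -> bnd l g ->
  bnd (k + l) (fun b j => f b j * g b j).
Proof.
move=> [K K0 HK] [L L0 HL]; exists (2 * (K * L)).
  by rewrite !mulr_ge0.
move=> j Pj; have [hf hfd] := HK _ Pj; have [hg hgd] := HL _ Pj.
have akj := ak k Pj; have alj := ak l Pj; have Dj := D0 Pj.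
have KLa : 0 <= K * L * a j ^+ (k + l) by rewrite !mulr_ge0// ak.
split=> [b|].
  rewrite normrM (le_trans (ler_pM _ _ (hf b) (hg b)))//.
  rewrite mulrACA -exprD; lra.
have -> : f true j * g true j - f false j * g false j =
  f true j * (g true j - g false j) + (f true j - f false j) * g false j.
  by ring.
rewrite (le_trans (ler_normD _ _))// !normrM.
rewrite (le_trans (lerD (ler_pM _ _ (hf true) hgd) (ler_pM _ _ hfd (hg false))))//.
by rewrite exprD le_eqVlt; apply/orP; left; apply/eqP; ring.
Qed.

Lemma bndM0l k f g : bnd 0 f -> bnd k g -> bnd k (fun b j => f b j * g b j).
Proof. exact: bndM. Qed.

Lemma bndZ k c f : bnd k f -> bnd k (fun b j => c * f b j).
Proof. exact/bndM0l/bnd_cst. Qed.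

Lemma bnd_weak k f : bnd k.+1 f -> bnd k f.
Proof.
(* [A] could be negative when [P] holds nowhere, hence the absolute value. *)
case: Ha => _ [_ [A HA]] [K K0 HK]; exists (K * `|A|); first exact: mulr_ge0.
move=> j Pj; have [hf hfd] := HK _ Pj; have akj := ak k Pj; have Dj := D0 Pj.
have aA : a j <= `|A| by rewrite (le_trans (HA _ Pj)) ?ler_norm.
split=> [b|].
  rewrite (le_trans (hf b))// exprS mulrA ler_wpM2r// ler_wpM2l//.
rewrite (le_trans hfd)// exprS mulrA ler_wpM2r// [leRHS]mulrAC ler_wpM2l//.
by rewrite mulr_ge0.
Qed.

Lemma bnd_le k l f : (k <= l)%N -> bnd l f -> bnd k f.
Proof.
move=> /subnK <-; elim: (l - k)%N => // n IH; rewrite addSn => /bnd_weak; exact: IH.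
Qed.

Lemma bnd0 k : bnd k (fun _ _ => 0).
Proof.
exists 0 => // j Pj; split; first by move=> _; rewrite normr0 mul0r.
by rewrite subrr normr0 !mul0r.
Qed.

Lemma bnd_sum k (I : finType) (F : I -> bool -> J -> R) :
  (forall i, bnd k (F i)) -> bnd k (fun b j => \sum_i F i b j).
Proof.
move=> HF.
suff H (s : seq I) : bnd k (fun b j => \sum_(i <- s) F i b j) by [].
elim: s => [|i s IH].
  by apply: bnd_ext (bnd0 k) => b j _; rewrite big_nil.
by apply: bnd_ext (bndD (HF i) IH) => b j _; rewrite big_cons.
Qed.

End Bnd.

(** Change of index: with [pi] the first projection it adds the mean value parameter, with [pi] the
    identity it restricts the family. *)
Lemma bnd_sub (R : realType) (J J' : Type) (P : J -> Prop) (P' : J' -> Prop)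
    (a D : J -> R) (a' D' : J' -> R) (pi : J' -> J) k f :
  (forall j, P' j -> [/\ P (pi j), a (pi j) = a' j & D (pi j) = D' j]) ->
  bnd P a D k f -> bnd P' a' D' k (fun b j => f b (pi j)).
Proof.
move=> H [K K0 HK]; exists K => // j /H[/HK + aj Dj]; rewrite aj Dj; exact.
Qed.

(** * Orders of matrices, entry by entry *)

Section MBnd.
Context (R : realType) (J : Type) (P : J -> Prop) (a D : J -> R).
Hypothesis Ha : valid_scale P a D.
Implicit Types (k l m n : nat).
Local Notation bnd := (bnd P a D).
Local Notation mbnd := (mbnd P a D).

Lemma mbnd_ext k m n (F G : bool -> J -> 'M[R]_(m, n)) :
  (forall b j, P j -> F b j = G b j) -> mbnd k F -> mbnd k G.
Proof. by move=> FG HF i l; apply: bnd_ext (HF i l) => b j /FG ->. Qed.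

Lemma mbndD k m n (F G : bool -> J -> 'M[R]_(m, n)) :
  mbnd k F -> mbnd k G -> mbnd k (fun b j => F b j + G b j).
Proof.
move=> HF HG i l; apply: bnd_ext (bndD (HF i l) (HG i l)) => b j _.
by rewrite !mxE.
Qed.

Lemma mbnd_sum k m n (I : finType) (F : I -> bool -> J -> 'M[R]_(m, n)) :
  (forall i, mbnd k (F i)) -> mbnd k (fun b j => \sum_i F i b j).
Proof.
move=> HF i l.
apply: bnd_ext (bnd_sum (F := fun x b j => F x b j i l) _) => [b j _|x].
  by rewrite summxE.
exact: HF.
Qed.

Lemma mbndZ k l m n f (F : bool -> J -> 'M[R]_(m, n)) :
  bnd k f -> mbnd l F -> mbnd (k + l) (fun b j => f b j *: F b j).
Proof.
by move=> Hf HF i h; apply: bnd_ext (bndM Ha Hf (HF i h)) => b j _; rewrite mxE.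
Qed.

Lemma mbnd_le k l m n (F : bool -> J -> 'M[R]_(m, n)) :
  (k <= l)%N -> mbnd l F -> mbnd k F.
Proof. by move=> kl HF i h; exact: bnd_le kl (HF i h). Qed.

Lemma mbnd_mul k l m n p (F : bool -> J -> 'M[R]_(m, n))
    (G : bool -> J -> 'M[R]_(n, p)) :
  mbnd k F -> mbnd l G -> mbnd (k + l) (fun b j => F b j *m G b j).
Proof.
move=> HF HG i h.
apply: bnd_ext
  (bnd_sum (F := fun x b j => F b j i x * G b j x h) _) => [b j _|x].
  by rewrite mxE.
exact: bndM.
Qed.

Lemma mbnd_row k m n (F : bool -> J -> 'M[R]_(m, n)) i :
  mbnd k F -> mbnd k (fun b j => row i (F b j)).
Proof. by move=> HF x h; apply: bnd_ext (HF i h) => b j _; rewrite mxE. Qed.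

End MBnd.

Lemma mbnd_sub (R : realType) (J J' : Type) (P : J -> Prop) (P' : J' -> Prop)
    (a D : J -> R) (a' D' : J' -> R) (pi : J' -> J) k m n
    (F : bool -> J -> 'M[R]_(m, n)) :
  (forall j, P' j -> [/\ P (pi j), a (pi j) = a' j & D (pi j) = D' j]) ->
  mbnd P a D k F -> mbnd P' a' D' k (fun b j => F b (pi j)).
Proof. by move=> H HF i l; exact: bnd_sub H (HF i l). Qed.

Lemma mbnd_bound (R : realType) (J : Type) (P : J -> Prop) (a D : J -> R) k m n
    (F : bool -> J -> 'M[R]_(m, n)) :
  valid_scale P a D -> mbnd P a D k F -> exists2 K, 0 <= K & forall j, P j ->
  (forall b i l, `|F b j i l| <= K * a j ^+ k) /\
  forall i l, `|F true j i l - F false j i l| <= K * D j * a j ^+ k.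
Proof.
move=> [a0 [D0 _]] HF.
have /choice[K HK] : forall il : 'I_m * 'I_n, exists K, 0 <= K /\ forall j, P j ->
    (forall b, `|F b j il.1 il.2| <= K * a j ^+ k) /\
    `|F true j il.1 il.2 - F false j il.1 il.2| <= K * D j * a j ^+ k.
  by move=> [i l]; have [K K0 HK] := HF i l; exists K.
have K0 il : 0 <= K il by have [] := HK il.
have Kle il : K il <= \sum_x K x.
  by rewrite (bigD1 il)//= lerDl sumr_ge0.
exists (\sum_x K x); first by rewrite sumr_ge0.
move=> j Pj; have ak : 0 <= a j ^+ k by rewrite exprn_ge0 ?a0.
split=> [b|] i l; have [_ /(_ _ Pj)[h1 h2]] := HK (i, l).
  by rewrite (le_trans (h1 b))// ler_wpM2r.
by rewrite (le_trans h2)// ler_wpM2r// ler_wpM2r ?D0.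
Qed.

(* Keeps the mean value parameter among the indices, so that a bound on the
   derivative is automatically uniform in it. *)
Definition unit_param (R : realType) (J : Type) (P : J -> Prop) (x : J * R) :=
  P x.1 /\ 0 <= x.2 <= 1.

Lemma scale_unit (R : realType) (J : Type) (P : J -> Prop) (a D : J -> R) :
  valid_scale P a D ->
  valid_scale (@unit_param R J P) (a \o fst) (D \o fst).
Proof.
move=> [a0 [D0 [A HA]]]; split; first by move=> j [/a0].
by split; [move=> j [/D0] | exists A => j [/HA]].
Qed.

Lemma MVT01 (R : realType) (f df : R -> R) :
  (forall x : R, is_derive x 1 f (df x)) -> f 0 = 0 ->
  exists2 x, 0 <= x <= 1 & f 1 = df x.
Proof.
move=> Hf f0.
have [|x] := @MVT R f df 0 1 ltr01 (fun x _ => Hf x).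
  apply: continuous_subspaceT => x; apply: differentiable_continuous.
  by apply/derivable1_diffP; have [] := Hf x.
rewrite in_itv/= f0 !subr0 mulr1 => /andP[x0 x1] ->; exists x => //.
by rewrite !ltW.
Qed.

(** The mean value theorem is applied to each version, and once more to the difference of the
    versions as a single function of the parameter. The two derivatives are then compared at one
    common point, which separate applications would not give. *)
Lemma bnd_mvt (R : realType) (J : Type) (P : J -> Prop) (a D : J -> R) k
    (f df : bool -> J -> R -> R) :
  (forall b j, P j -> forall x : R, is_derive x 1 (f b j) (df b j x)) ->
  (forall b j, P j -> f b j 0 = 0) ->
  bnd (@unit_param R J P) (a \o fst) (D \o fst) k (fun b x => df b x.1 x.2) ->
  bnd P a D k (fun b j => f b j 1).
Proof.
move=> Hf f0 [K K0 HK]; exists K => // j Pj; split=> [b|].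
  have [x x01 ->] := MVT01 (Hf b j Pj) (f0 b j Pj).
  by have [] := HK (j, x) (conj Pj x01).
have Hd (x : R) : is_derive x 1 (f true j - f false j) (df true j x - df false j x).
  by have := Hf true j Pj x; have := Hf false j Pj x; move=> h1 h2; apply: is_deriveB.
have [|x x01 ] := MVT01 Hd.
  by rewrite -[LHS]/(f true j 0 - f false j 0) !f0// subrr.
rewrite -[LHS]/(f true j 1 - f false j 1) => ->.
by have [_] := HK (j, x) (conj Pj x01).
Qed.

(** * Taylor expansions *)

Lemma is_derive_line (R : realType) m n (f : 'rV[R]_m -> 'rV[R]_n)
    (x h : 'rV[R]_m) (c : 'I_n) (t : R) :
  (forall y, differentiable f y) ->
  is_derive t 1 (fun t : R => f (x + t *: h) 0 c) ('d f (x + t *: h) h 0 c).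
Proof.
move=> df.
pose l (t : R) := x + t *: h.
have dl : is_diff t l (fun s => 0 + s *: h).
  exact: (@is_diffD R R _ (cst x) (fun s => s *: h)).
(* A coordinate is a continuous linear map, hence its own differential; packing it as such lets the
   chain rule go through. *)
pose g (N : 'rV[R]_n) := N 0 c.
have gL : linear g by move=> k u v; rewrite /g !mxE.
pose gM := GRing.isLinear.Build _ _ _ _ _ gL.
pose gl : {linear _ -> _} := HB.pack g gM.
have cg : continuous gl by exact: coord_continuous.
have dg y : is_diff y g g.
  by apply: DiffDef; [exact: differentiable_coord|exact: (diff_lin y cg)].
have dfl : is_diff (l t) f ('d f (l t)) by apply: DiffDef; first exact: df.
have D := @is_diff_comp R _ _ _ _ _ _ _ _
  (@is_diff_comp R _ _ _ _ _ _ _ _ dl dfl) (dg _).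
have /diff_derivable dd : differentiable (g \o (f \o l)) t by [].
split; first exact: dd.
rewrite [LHS](@deriveE R _ _ (g \o (f \o l)))// (diff_val (is_diff_def := D))/=.
by rewrite scale1r add0r.
Qed.

(** The shape of the functions that [taylor2] and [taylor3] feed to [bnd_mvt]: a function along a
    line minus its Taylor polynomial, with [l] zero at second order and half the Hessian term at
    third order. *)
Lemma is_derive_subquad (R : realType) (F : R -> R) (dF c k l t : R) :
  is_derive t 1 F dF ->
  is_derive t 1 (fun t => F t - c - t * k - t ^+ 2 * l) (dF - k - t * (2 * l)).
Proof.
move=> H.
have I := @is_derive_id R R t 1.
have K x := @is_derive_cst R R R x t 1.
have := is_deriveB (is_deriveB (is_deriveB H (K c)) (is_deriveM I (K k)))
  (is_deriveM (is_deriveM I I) (K l)).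
rewrite /GRing.scale/=.
set f := (X in is_derive _ _ X _); set d := (X in is_derive _ _ _ X) => HH.
have -> : dF - k - t * (2 * l) = d by rewrite /d; ring.
exact: HH.
Qed.

(** [classC] speaks of derivatives in a fixed direction; a direction that varies with the index is
    expanded in the standard basis to reach such directions. *)
Lemma diff_coord_sum (R : realType) m n (f : 'rV[R]_m -> 'rV[R]_n)
    (x h : 'rV[R]_m) :
  'd f x h = \sum_i h 0 i *: 'd f x (delta_mx 0 i).
Proof.
rewrite {1}(row_sum_delta h) linear_sum.
by under eq_bigr do rewrite linearZ.
Qed.

Lemma diff_coord_sumE (R : realType) m n (f : 'rV[R]_m -> 'rV[R]_n)
    (x h : 'rV[R]_m) c :
  'd f x h 0 c = \sum_i h 0 i * 'd f x (delta_mx 0 i) 0 c.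
Proof. by rewrite diff_coord_sum summxE; apply: eq_bigr => i _; rewrite mxE. Qed.

Lemma classC_weak (R : realType) m n k (f : 'rV[R]_m -> 'rV[R]_n) :
  classC k.+1 f -> classC k f.
Proof.
elim: k f => [f [df _] x|k IH f [df Hf]]; first exact: differentiable_continuous.
by split=> // v; apply: IH; exact: Hf.
Qed.

Lemma box_bound (R : realType) m (g : 'rV[R]_m -> R) (r : R) : continuous g ->
  exists2 K : R, 0 <= K &
    forall y : 'rV[R]_m, (forall i, `|y 0 i| <= r) -> `|g y| <= K.
Proof.
move=> cg.
pose B := [set y : 'rV[R]_m | forall i, (`[- r, r]%classic : set R) (y ord0 i)].
have cB : compact B.
  by apply: (@rV_compact _ _ (fun=> `[- r, r]%classic)) => _; exact: segment_compact.
have /compact_bounded[K [_ HK]] : compact (g @` B).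
  by apply: continuous_compact => //; exact: continuous_subspaceT.
(* [compact_bounded] bounds the image by every number larger than [K]. *)
exists (`|K| + 1); first by rewrite addr_ge0.
move=> y Hy; apply: HK; first by rewrite ltr_pwDr// ler_norm.
by exists y => // i; rewrite /= in_itv/= -ler_norml.
Qed.

Lemma continuous_rV_coord (R : realType) m n (f : 'rV[R]_m -> 'rV[R]_n) c :
  continuous f -> continuous (fun y => f y 0 c).
Proof.
move=> cf y; apply: (@continuous_comp _ _ _ f (fun N : 'rV[R]_n => N 0 c)).
  exact: cf.
exact: coord_continuous.
Qed.

Section Taylor.
Context (R : realType) (m n : nat).
Implicit Types (f : 'rV[R]_m -> 'rV[R]_n).

(** Here the two versions of the point are joined by a segment. It stays in the box of radius [r],
    which is convex, and on this compact box [f] and its partial derivatives are bounded. *)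
Lemma taylor0 (J : Type) (P : J -> Prop) (a D : J -> R) f
    (p : bool -> J -> 'rV[R]_m) : valid_scale P a D ->
  classC 1 f -> mbnd P a D 0 p -> mbnd P a D 0 (fun b j => f (p b j)).
Proof.
move=> Ha [df Hf] Hp i c; rewrite {i}ord1.
have [r r0 Hr] := mbnd_bound Ha Hp; have [a0 [D0 _]] := Ha.
have [K K0 HK] : exists2 K : R, 0 <= K &
    forall y : 'rV[R]_m, (forall i, `|y 0 i| <= r) -> `|f y 0 c| <= K.
  apply: (@box_bound R m (fun y => f y 0 c)).
  by apply: continuous_rV_coord => y; exact: differentiable_continuous.
have /choice[L HL] : forall i, exists L : R, 0 <= L /\
    forall y : 'rV[R]_m, (forall i, `|y 0 i| <= r) ->
      `|'d f y (delta_mx 0 i) 0 c| <= L.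
  move=> i.
  have [|L L0 HL] := @box_bound R m (fun y => 'd f y (delta_mx 0 i) 0 c) r.
    by apply: (continuous_rV_coord (f := fun y => 'd f y (delta_mx 0 i))); exact: Hf.
  by exists L.
exists (K + \sum_i r * L i).
  by rewrite addr_ge0// sumr_ge0// => i _; rewrite mulr_ge0//; have [] := HL i.
have S0 : 0 <= \sum_i r * L i.
  by rewrite sumr_ge0// => i _; rewrite mulr_ge0//; have [] := HL i.
move=> j Pj; rewrite expr0 !mulr1; have [hb hd] := Hr _ Pj; split=> [b|].
  rewrite (le_trans (HK _ _))//; last by rewrite lerDl.
  by move=> i; rewrite (le_trans (hb _ _ _))// expr0 mulr1.
pose q := p false j; pose h := p true j - q.
have [t| |t] := @MVT01 R (fun t : R => f (q + t *: h) 0 c - f q 0 c)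
  (fun t => 'd f (q + t *: h) h 0 c).
- have H := is_derive_line q h c t df.
  have := @is_deriveB _ _ _ _ (cst (f q 0 c)) _ _ _ _ H (is_derive_cst _ _ _).
  by rewrite subr0.
- by rewrite scale0r addr0 subrr.
move=> /andP[t0 t1]; rewrite scale1r [q + h]addrC subrK => ->.
rewrite diff_coord_sum summxE (le_trans (ler_norm_sum _ _ _))//.
apply: (@le_trans _ _ (\sum_i r * L i * D j)); last first.
  by rewrite -mulr_suml ler_wpM2r ?D0// lerDr.
apply: ler_sum => i _; rewrite mxE normrM mulrAC ler_pM//.
  by rewrite !mxE; have := hd 0 i; rewrite expr0 mulr1.
have [_ ] := HL i; apply => l.
have -> : (q + t *: h) 0 l = (1 - t) * p false j 0 l + t * p true j 0 l.
  by rewrite !mxE /q; ring.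
have := hb true 0 l; have := hb false 0 l; rewrite expr0 mulr1 => h1 h2.
rewrite (le_trans (ler_normD _ _))// !normrM (ger0_norm t0) ger0_norm ?subr_ge0//.
have -> : r = (1 - t) * r + t * r by ring.
by rewrite lerD// ler_wpM2l// subr_ge0.
Qed.

Lemma mbnd_fst (J : Type) (P : J -> Prop) (a D : J -> R) k
    (h : bool -> J -> 'rV[R]_m) :
  mbnd P a D k h ->
  mbnd (@unit_param R J P) (a \o fst) (D \o fst) k (fun b x => h b x.1).
Proof. by apply: mbnd_sub => x []. Qed.

Lemma mbnd_scale_snd (J : Type) (P : J -> Prop) (a D : J -> R) k
    (h : bool -> J -> 'rV[R]_m) : valid_scale P a D ->
  mbnd P a D k h ->
  mbnd (@unit_param R J P) (a \o fst) (D \o fst) k (fun b x => x.2 *: h b x.1).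
Proof.
move=> Ha Hh; rewrite -[k]add0n; apply: mbndZ; [exact: scale_unit| |exact: mbnd_fst].
exists 1 => // x [Px /andP[x0 x1]]; split.
  by rewrite expr0 mulr1 ger0_norm.
by rewrite subrr normr0 expr0 mulr1 mul1r; have [_ [+ _]] := Ha; apply.
Qed.

Lemma mbnd_line (J : Type) (P : J -> Prop) (a D : J -> R)
    (p h : bool -> J -> 'rV[R]_m) : valid_scale P a D ->
  mbnd P a D 0 p -> mbnd P a D 1 h ->
  mbnd (@unit_param R J P) (a \o fst) (D \o fst) 0
    (fun b x => p b x.1 + x.2 *: h b x.1).
Proof.
move=> Ha Hp Hh; apply: mbndD; first exact: mbnd_fst.
apply: mbnd_le (mbnd_scale_snd Ha Hh) => //; exact: scale_unit.
Qed.

Lemma bnd_diff (J : Type) (P : J -> Prop) (a D : J -> R) f k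
    (p h : bool -> J -> 'rV[R]_m) : valid_scale P a D ->
  classC 2 f -> mbnd P a D 0 p -> mbnd P a D k h ->
  mbnd P a D k (fun b j => 'd f (p b j) (h b j)).
Proof.
move=> Ha [df Hf] Hp Hh.
apply: mbnd_ext (mbnd_sum (F := fun i b j =>
  h b j 0 i *: 'd f (p b j) (delta_mx 0 i)) _) => [b j _|i].
  by rewrite [RHS]diff_coord_sum.
rewrite -(addn0 k); apply: mbndZ => //.
exact: (taylor0 (f := fun y => 'd f y (delta_mx 0 i))).
Qed.

(** Along the segment the derivative is ['d f] applied to [h], and [h] supplies the order. The
    second derivative serves to compare ['d f] at the two versions of the point. *)
Lemma taylor1 (J : Type) (P : J -> Prop) (a D : J -> R) f
    (p h : bool -> J -> 'rV[R]_m) : valid_scale P a D ->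
  classC 2 f -> mbnd P a D 0 p -> mbnd P a D 1 h ->
  mbnd P a D 1 (fun b j => f (p b j + h b j) - f (p b j)).
Proof.
move=> Ha Hf Hp Hh i c; rewrite {i}ord1; have [df _] := Hf.
pose F b j (t : R) := f (p b j + t *: h b j) 0 c - f (p b j) 0 c.
pose G b j (t : R) := 'd f (p b j + t *: h b j) (h b j) 0 c.
apply: (@bnd_ext _ _ _ _ _ _ (fun b j => F b j 1)).
  by move=> b j _; rewrite /F !mxE scale1r.
apply: (@bnd_mvt _ _ _ _ _ _ F G) => [b j _ t|b j _|].
- have H := is_derive_line (p b j) (h b j) c t df.
  have := @is_deriveB _ _ _ _ (cst (f (p b j) 0 c)) _ _ _ _ H (is_derive_cst _ _ _).
  by rewrite subr0.
- by rewrite /F scale0r addr0 subrr.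
have Hu := scale_unit Ha.
suff : mbnd (@unit_param R J P) (a \o fst) (D \o fst) 1
  (fun b x => 'd f (p b x.1 + x.2 *: h b x.1) (h b x.1)) by apply.
by apply: bnd_diff => //; [exact: mbnd_line|exact: mbnd_fst].
Qed.

(** Induction on the order: the derivative in the parameter is the sum of h_i times the first-order
    increment of the i-th partial derivative, of orders 1 and 1. [taylor3] repeats the step with
    second-order remainders, of orders 1 and 2. *)
Lemma taylor2 (J : Type) (P : J -> Prop) (a D : J -> R) f
    (p h : bool -> J -> 'rV[R]_m) : valid_scale P a D ->
  classC 3 f -> mbnd P a D 0 p -> mbnd P a D 1 h ->
  mbnd P a D 2 (fun b j => f (p b j + h b j) - f (p b j) - 'd f (p b j) (h b j)).
Proof.
move=> Ha Hf Hp Hh i c; rewrite {i}ord1; have [df Hdf] := Hf.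
(* The vanishing quadratic term is there to match [is_derive_subquad]. *)
pose F b j (t : R) := f (p b j + t *: h b j) 0 c - f (p b j) 0 c -
  t * 'd f (p b j) (h b j) 0 c - t ^+ 2 * 0.
pose G b j (t : R) := 'd f (p b j + t *: h b j) (h b j) 0 c -
  'd f (p b j) (h b j) 0 c.
apply: (@bnd_ext _ _ _ _ _ _ (fun b j => F b j 1)).
  by move=> b j _; rewrite /F !mxE scale1r mul1r mulr0 subr0.
apply: (@bnd_mvt _ _ _ _ _ _ F G) => [b j _ t|b j _|].
- have H := is_derive_line (p b j) (h b j) c t df.
  have := is_derive_subquad (f (p b j) 0 c) ('d f (p b j) (h b j) 0 c) 0 H.
  by rewrite !mulr0 subr0.
- by rewrite /F scale0r addr0 mul0r mulr0 !subrr.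
have Hu := scale_unit Ha.
suff : mbnd (@unit_param R J P) (a \o fst) (D \o fst) 2
    (fun b x => \sum_i h b x.1 0 i *:
      ('d f (p b x.1 + x.2 *: h b x.1) (delta_mx 0 i) -
       'd f (p b x.1) (delta_mx 0 i))).
  move=> /(_ 0 c); apply: bnd_ext => b x _; rewrite /G.
  set z := p b x.1 + _.
  transitivity (\sum_i h b x.1 0 i * 'd f z (delta_mx 0 i) 0 c -
    \sum_i h b x.1 0 i * 'd f (p b x.1) (delta_mx 0 i) 0 c).
    by rewrite summxE -sumrB; apply: eq_bigr => i _; rewrite !mxE mulrBr.
  by congr (_ - _); symmetry; exact: diff_coord_sumE.
apply: mbnd_sum => i; rewrite -[2%N]/(1 + 1)%N; apply: mbndZ => //.
  exact: (mbnd_fst Hh).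
apply: (taylor1 (f := fun y => 'd f y (delta_mx 0 i))) => //.
- exact: mbnd_fst.
- exact: mbnd_scale_snd.
Qed.

(** Linearity in [v] is that of a differential, but [w] sits inside the differentiated function:
    here the partial derivatives must be differentiable, so that differentiation commutes with the
    finite sum. *)
Lemma hessian_coord_sum f (x v w : 'rV[R]_m) : classC 2 f ->
  hessian f x v w = \sum_i w 0 i *: hessian f x v (delta_mx 0 i).
Proof.
move=> [df Hdf]; rewrite /hessian.
have -> : (fun y => 'd f y w) =
    \sum_i (w 0 i \*: (fun y => 'd f y (delta_mx 0 i))).
  by apply/funext => y; rewrite fct_sumE; exact: diff_coord_sum.
have dH i : differentiable (fun y => 'd f y (delta_mx 0 i)) x.
  by have [] := Hdf (delta_mx 0 i).
pose g i y := 'd f y (delta_mx 0 i); rewrite -/(g _) in dH.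
have dg i : is_derive x v (g i) ('d (g i) x v).
  have dv := @diff_derivable _ _ _ _ _ v (dH i).
  exact: (is_derive_eq (derivableP dv) (deriveE v (dH i))).
have dS := is_derive_sum (fun i => is_deriveZ (w 0 i) (dg i)).
have E : differentiable (\sum_i (w 0 i \*: g i)) x.
  by apply: differentiable_sum => i; exact: (differentiableZ _ (dH i)).
exact: (etrans (esym (deriveE v E)) (derive_val (is_derive := dS))).
Qed.

Lemma hessianZl f (x v w : 'rV[R]_m) (k : R) :
  hessian f x (k *: v) w = k *: hessian f x v w.
Proof. exact: linearZ. Qed.

Lemma taylor3 (J : Type) (P : J -> Prop) (a D : J -> R) f
    (p h : bool -> J -> 'rV[R]_m) : valid_scale P a D ->
  classC 4 f -> mbnd P a D 0 p -> mbnd P a D 1 h ->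
  mbnd P a D 3 (fun b j => f (p b j + h b j) - f (p b j) - 'd f (p b j) (h b j)
    - 2^-1 *: hessian f (p b j) (h b j) (h b j)).
Proof.
move=> Ha Hf Hp Hh i c; rewrite {i}ord1; have [df Hdf] := Hf.
pose F b j (t : R) := f (p b j + t *: h b j) 0 c - f (p b j) 0 c -
  t * 'd f (p b j) (h b j) 0 c -
  t ^+ 2 * (2^-1 * hessian f (p b j) (h b j) (h b j) 0 c).
pose G b j (t : R) := 'd f (p b j + t *: h b j) (h b j) 0 c -
  'd f (p b j) (h b j) 0 c - t * hessian f (p b j) (h b j) (h b j) 0 c.
apply: (@bnd_ext _ _ _ _ _ _ (fun b j => F b j 1)).
  by move=> b j _; rewrite /F !mxE scale1r expr1n !mul1r.
apply: (@bnd_mvt _ _ _ _ _ _ F G) => [b j _ t|b j _|].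
- have H := is_derive_line (p b j) (h b j) c t df.
  have := is_derive_subquad (f (p b j) 0 c) ('d f (p b j) (h b j) 0 c)
    (2^-1 * hessian f (p b j) (h b j) (h b j) 0 c) H.
  by rewrite mulVKf ?pnatr_eq0.
- by rewrite /F scale0r addr0 expr0n !mul0r !subrr.
have Hu := scale_unit Ha.
suff : mbnd (@unit_param R J P) (a \o fst) (D \o fst) 3
    (fun b x => \sum_i h b x.1 0 i *:
      ('d f (p b x.1 + x.2 *: h b x.1) (delta_mx 0 i) -
       'd f (p b x.1) (delta_mx 0 i) -
       hessian f (p b x.1) (x.2 *: h b x.1) (delta_mx 0 i))).
  move=> /(_ 0 c); apply: bnd_ext => b x _; rewrite /G.
  set z := p b x.1 + _.
  transitivity (\sum_i h b x.1 0 i * 'd f z (delta_mx 0 i) 0 c -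
    \sum_i h b x.1 0 i * 'd f (p b x.1) (delta_mx 0 i) 0 c -
    x.2 * \sum_i h b x.1 0 i *
      hessian f (p b x.1) (h b x.1) (delta_mx 0 i) 0 c).
    rewrite summxE mulr_sumr -!sumrB; apply: eq_bigr => i _.
    have dist (q u1 u2 u3 t : R) :
      q * (u1 - u2 - t * u3) = q * u1 - q * u2 - t * (q * u3) by ring.
    by rewrite !mxE hessianZl !mxE; exact: dist.
  congr (_ - _ - _ * _); [exact/esym/diff_coord_sumE|exact/esym/diff_coord_sumE|].
  rewrite hessian_coord_sum; last by do 2 apply: classC_weak.
  by rewrite summxE; apply: eq_bigr => i _; rewrite mxE.
apply: mbnd_sum => i; rewrite -[3%N]/(1 + 2)%N; apply: mbndZ => //.
  exact: (mbnd_fst Hh).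
apply: (taylor2 (f := fun y => 'd f y (delta_mx 0 i))) => //.
- exact: mbnd_fst.
- exact: mbnd_scale_snd.
Qed.

Lemma bnd_hessian (J : Type) (P : J -> Prop) (a D : J -> R) f k l
    (p v w : bool -> J -> 'rV[R]_m) : valid_scale P a D ->
  classC 3 f -> mbnd P a D 0 p -> mbnd P a D k v -> mbnd P a D l w ->
  mbnd P a D (k + l) (fun b j => hessian f (p b j) (v b j) (w b j)).
Proof.
move=> Ha [df Hdf] Hp Hv Hw; rewrite addnC.
apply: mbnd_ext (mbnd_sum (F := fun i b j =>
  w b j 0 i *: hessian f (p b j) (v b j) (delta_mx 0 i)) _) => [b j _|i].
  by rewrite [RHS]hessian_coord_sum//; apply: classC_weak.
apply: mbndZ => //.
exact: (bnd_diff (f := fun y => 'd f y (delta_mx 0 i))).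
Qed.

Section Endpoints.
Context (J : Type) (P : J -> Prop) (a D : J -> R).
Context (f : 'rV[R]_m -> 'rV[R]_n) (p q : bool -> J -> 'rV[R]_m).
Hypotheses (Ha : valid_scale P a D) (Hp : mbnd P a D 0 p).
Hypothesis Hpq : mbnd P a D 1 (fun b j => q b j - p b j).

Lemma taylor1_incr : classC 2 f ->
  mbnd P a D 1 (fun b j => f (q b j) - f (p b j)).
Proof.
move=> Hf; apply: mbnd_ext (taylor1 Ha Hf Hp Hpq) => b j _.
by rewrite subrKC.
Qed.

Lemma taylor2_incr : classC 3 f -> mbnd P a D 2
  (fun b j => f (q b j) - f (p b j) - 'd f (p b j) (q b j - p b j)).
Proof.
move=> Hf; apply: mbnd_ext (taylor2 Ha Hf Hp Hpq) => b j _.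
by congr (f _ - _ - _); rewrite subrKC.
Qed.

Lemma taylor3_incr : classC 4 f -> mbnd P a D 3
  (fun b j => f (q b j) - f (p b j) - 'd f (p b j) (q b j - p b j)
    - 2^-1 *: hessian f (p b j) (q b j - p b j) (q b j - p b j)).
Proof.
move=> Hf; apply: mbnd_ext (taylor3 Ha Hf Hp Hpq) => b j _.
by congr (f _ - _ - _ - _); rewrite subrKC.
Qed.

End Endpoints.

End Taylor.

(** * Bilinearity and symmetry of the second derivative *)

Section Hessian.
Context (R : realType) (m n : nat).
Implicit Types (f : 'rV[R]_m -> 'rV[R]_n) (x v w : 'rV[R]_m).

Lemma diffZr f x v (k : R) : 'd f x (k *: v) = k *: 'd f x v.
Proof. exact: linearZ. Qed.

Lemma hessianDr f x v w w' : classC 2 f ->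
  hessian f x v (w + w') = hessian f x v w + hessian f x v w'.
Proof.
move=> Hf; rewrite (hessian_coord_sum x v (w + w') Hf).
rewrite (hessian_coord_sum x v w Hf) (hessian_coord_sum x v w' Hf) -big_split.
by apply: eq_bigr => i _; rewrite mxE scalerDl.
Qed.

Lemma hessianZr f x v w (k : R) : classC 2 f ->
  hessian f x v (k *: w) = k *: hessian f x v w.
Proof.
move=> Hf; rewrite (hessian_coord_sum x v (k *: w) Hf).
rewrite (hessian_coord_sum x v w Hf) scaler_sumr.
by apply: eq_bigr => i _; rewrite mxE scalerA.
Qed.

(* The mixed second difference of f in the directions t v and t w is
   t^2 hessian f x v w + O(t^3), and it is symmetric in v and w. *)
Lemma hessian_sym f x v w : classC 4 f -> hessian f x v w = hessian f x w v.
Proof.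
move=> Hf; apply/rowP => c.
pose P (t : R) := 0 < t /\ t <= 1.
(* Only sizes matter here: the scale is [t] itself, the two versions coincide and their distance is
   0. *)
have Hs : valid_scale P id (fun=> 0 : R).
  by split; [move=> t [/ltW]|split=> //; exists 1 => t []].
have cst (y : 'rV[R]_m) : mbnd P id (fun=> 0) 0 (fun (_ : bool) (_ : R) => y).
  by move=> i l; exact: bnd_cst.
have bt : bnd P id (fun=> 0) 1 (fun _ t => t).
  exists 1 => // t [t0 _]; split=> [_|]; first by rewrite gtr0_norm// mul1r.
  by rewrite subrr normr0 mulr0 mul0r.
have bZ (y : 'rV[R]_m) : mbnd P id (fun=> 0) 1 (fun _ t => t *: y).
  exact: (mbndZ Hs bt (cst y)).
have H2 : classC 2 f by do 2 apply: classC_weak.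
have [Hd Hdd] := Hf.
(* The terms in [f] are symmetric in [v'] and [w'], so the difference of the two instances leaves
   t^2 times the difference of the Hessians, which is thus O(t^3); t tends to 0. *)
suff main v' w' : bnd P id (fun=> 0) 3 (fun _ t =>
   f (x + t *: v' + t *: w') 0 c - f (x + t *: v') 0 c - f (x + t *: w') 0 c
   + f x 0 c - t ^+ 2 * hessian f x v' w' 0 c).
  have [K K0 HK] := bndB (main v w) (main w v).
  apply/eqP; rewrite -subr_eq0 -normr_le0; apply/ler_addgt0Pl => e e0.
  rewrite addr0.
  (* Small enough for K t <= e; [K + 1] keeps the denominator positive. *)
  pose t := Num.min 1 (e / (K + 1)).
  have K1 : 0 < K + 1 by rewrite ltr_pwDr.
  have t0 : 0 < t by rewrite lt_min ltr01 divr_gt0.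
  have tK : K * t <= e.
    rewrite (@le_trans _ _ ((K + 1) * t))//.
      by apply: ler_wpM2r; [exact: ltW|rewrite lerDl].
    by rewrite mulrC -ler_pdivlMr// ge_min lexx orbT.
  have [|/(_ true) + _] := HK t.
    by split=> //; rewrite ge_min lexx.
  rewrite [x + t *: w + _]addrAC.
  set X := (X in `|X| <= _).
  have -> : X = - t ^+ 2 * (hessian f x v w 0 c - hessian f x w v 0 c).
    rewrite /X; move: (hessian f x v w 0 c) (hessian f x w v 0 c) => h1 h2.
    move: (f _ 0 c) (f _ 0 c) (f _ 0 c) (f x 0 c) => f1 f2 f3 f4; ring.
  rewrite normrM normrN (gtr0_norm (exprn_gt0 2 t0)) (exprSr t 2) mulrCA mulrC.
  rewrite [t ^+ 2 * _]mulrC ler_pM2r ?exprn_gt0// => h; exact: le_trans h tK.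
have Hp : mbnd P id (fun=> 0) 0 (fun (_ : bool) t => x + t *: v').
  by apply: mbndD => //; exact: mbnd_le (bZ v').
have T3 p : mbnd P id (fun=> 0) 0 (fun (_ : bool) => p) ->
    bnd P id (fun=> 0) 3 (fun _ t => f (p t + t *: w') 0 c - f (p t) 0 c
      - t * 'd f (p t) w' 0 c - t ^+ 2 * (2^-1 * hessian f (p t) w' w' 0 c)).
  move=> Hpt; have := taylor3 Hs Hf Hpt (bZ w') 0 c.
  apply: bnd_ext => _ t _; rewrite !mxE; congr (_ - _ - _).
    by rewrite diffZr mxE.
  by rewrite hessianZl hessianZr// !mxE; ring.
(* These are the expansions in direction [w'] from x + t v' and from x; in their difference, [A3]
   and [A4] expand the coefficients of t and t^2 along [v']. *)
have A1 := T3 _ Hp; have A2 := T3 _ (cst x).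
have A3 : bnd P id (fun=> 0) 2 (fun _ t => 'd f (x + t *: v') w' 0 c
    - 'd f x w' 0 c - t * hessian f x v' w' 0 c).
  have := taylor2 Hs (Hdd w') (cst x) (bZ v') 0 c.
  apply: bnd_ext => _ t _; rewrite !mxE; congr (_ - _).
  by rewrite diffZr mxE.
have A4 : bnd P id (fun=> 0) 1 (fun _ t => hessian f (x + t *: v') w' w' 0 c
    - hessian f x w' w' 0 c).
  have [_ Hddd] := Hdd w'.
  have := taylor1 Hs (Hddd w') (cst x) (bZ v') 0 c.
  by apply: bnd_ext => _ t _; rewrite !mxE.
have B3 := bndM Hs bt A3.
have B4 := bndZ Hs 2^-1 (bndM Hs (bndM Hs bt bt) A4).
have := bndD (bndD (bndB A1 A2) B3) B4.
apply: bnd_ext => _ t _.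
have dist (f1 f2 f3 f4 d1 d2 h1 h2 h3 : R) :
  f1 - f2 - t * d1 - t ^+ 2 * (2^-1 * h1)
  - (f3 - f4 - t * d2 - t ^+ 2 * (2^-1 * h2))
  + t * (d1 - d2 - t * h3) + 2^-1 * (t * t * (h1 - h2)) =
  f1 - f2 - f3 + f4 - t ^+ 2 * h3 by ring.
exact: dist.
Qed.

End Hessian.

(** * Increments of the derivatives between two points *)

Section Increments.
Context (R : realType) (m n : nat) (J : Type) (P : J -> Prop) (a D : J -> R).
Hypothesis Ha : valid_scale P a D.
Context (f : 'rV[R]_m -> 'rV[R]_n) (p q : bool -> J -> 'rV[R]_m).
Hypotheses (Hp : mbnd P a D 0 p) (Hpq : mbnd P a D 1 (fun b j => q b j - p b j)).
Implicit Types (k l : nat) (v w : bool -> J -> 'rV[R]_m).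

Lemma bnd_diff_incr l v : classC 3 f -> mbnd P a D l v ->
  mbnd P a D (1 + l)
    (fun b j => 'd f (q b j) (v b j) - 'd f (p b j) (v b j)).
Proof.
move=> [_ Hdf] Hv; rewrite addnC.
apply: mbnd_ext (mbnd_sum (F := fun i b j => v b j 0 i *:
  ('d f (q b j) (delta_mx 0 i) - 'd f (p b j) (delta_mx 0 i))) _)
  => [b j _|i].
  under eq_bigr do rewrite scalerBr.
  by rewrite sumrB; congr (_ - _); exact/esym/diff_coord_sum.
apply: mbndZ => //.
exact: (taylor1_incr Ha Hp Hpq (Hdf (delta_mx 0 i : 'rV_m))).
Qed.

Lemma bnd_diff_taylor l v : classC 4 f -> mbnd P a D l v ->
  mbnd P a D (2 + l)
    (fun b j => 'd f (q b j) (v b j) - 'd f (p b j) (v b j)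
                - hessian f (p b j) (q b j - p b j) (v b j)).
Proof.
move=> Hf Hv; rewrite addnC; have [_ Hdf] := Hf.
apply: mbnd_ext (mbnd_sum (F := fun i b j => v b j 0 i *:
  ('d f (q b j) (delta_mx 0 i) - 'd f (p b j) (delta_mx 0 i)
   - hessian f (p b j) (q b j - p b j) (delta_mx 0 i))) _) => [b j _|i].
  under eq_bigr do rewrite !scalerBr.
  rewrite !sumrB; congr (_ - _ - _); [exact/esym/diff_coord_sum..|].
  by apply/esym/hessian_coord_sum; do 2 apply: classC_weak.
apply: mbndZ => //.
exact: (taylor2_incr Ha Hp Hpq (Hdf (delta_mx 0 i : 'rV_m))).
Qed.

(** Both directions are expanded in the standard basis, down to increments of second partial
    derivatives; these are C^2, as [taylor1_incr] asks. *)
Lemma bnd_hessian_incr k l v w : classC 4 f ->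
  mbnd P a D k v -> mbnd P a D l w ->
  mbnd P a D (1 + k + l)
    (fun b j => hessian f (q b j) (v b j) (w b j)
                - hessian f (p b j) (v b j) (w b j)).
Proof.
move=> Hf Hv Hw; rewrite addnC; have [_ Hdf] := Hf.
have H2 : classC 2 f by do 2 apply: classC_weak.
apply: mbnd_ext (mbnd_sum (F := fun i b j => w b j 0 i *:
  (hessian f (q b j) (v b j) (delta_mx 0 i)
   - hessian f (p b j) (v b j) (delta_mx 0 i))) _) => [b j _|i].
  under eq_bigr do rewrite scalerBr.
  by rewrite sumrB; congr (_ - _); exact/esym/hessian_coord_sum.
apply: mbndZ => //.
have H := Hdf (delta_mx 0 i : 'rV_m).
apply: mbnd_ext (mbnd_sum (F := fun i' b j => v b j 0 i' *:
  (hessian f (q b j) (delta_mx 0 i') (delta_mx 0 i)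
   - hessian f (p b j) (delta_mx 0 i') (delta_mx 0 i))) _) => [b j _|i'].
  under eq_bigr do rewrite scalerBr.
  by rewrite sumrB; congr (_ - _); exact/esym/diff_coord_sum.
rewrite addnC; apply: mbndZ => //.
have [_ H'] := H.
exact: (taylor1_incr Ha Hp Hpq (H' (delta_mx 0 i' : 'rV_m))).
Qed.

End Increments.

(** * Contractions of cubes with vectors and matrices *)

Section CubeBnd.
Context (R : realType) (d e : nat) (J : Type) (P : J -> Prop) (a D : J -> R).
Hypothesis Ha : valid_scale P a D.

Lemma mbnd_cube_app1 k l (A : bool -> J -> cube R d e)
    (v : bool -> J -> 'rV[R]_d) :
  (forall i, mbnd P a D k (fun b j => A b j i)) -> mbnd P a D l v ->
  mbnd P a D (k + l) (fun b j => cube_app1 (A b j) (v b j)).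
Proof.
move=> HA Hv; rewrite addnC.
apply: (mbnd_sum (F := fun i b j => v b j 0 i *: A b j i)) => i.
by apply: mbndZ => //; exact: (HA i).
Qed.

Lemma mbnd_cube_app2 k l (A : bool -> J -> cube R d e)
    (x : bool -> J -> 'M[R]_d) :
  (forall i, mbnd P a D k (fun b j => A b j i)) -> mbnd P a D l x ->
  mbnd P a D (k + l) (fun b j => cube_app2 (A b j) (x b j)).
Proof.
move=> HA Hx; rewrite addnC.
apply: (mbnd_sum (F := fun i b j =>
  \sum_i' x b j i i' *: row i' (A b j i))) => i.
apply: (mbnd_sum (F := fun i' b j => x b j i i' *: row i' (A b j i))) => i'.
apply: mbndZ => //; apply: mbnd_row; exact: (HA i).
Qed.

Lemma row_cube_app1 (A : cube R d e) (v : 'rV[R]_d) j :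
  row j (cube_app1 A v) = \sum_i v 0 i *: row j (A i).
Proof.
by apply/rowP => c; rewrite mxE !summxE; apply: eq_bigr => i _; rewrite !mxE.
Qed.

Lemma mbnd_rows k m n (F : bool -> J -> 'M[R]_(m, n)) :
  (forall i, mbnd P a D k (fun b j => row i (F b j))) -> mbnd P a D k F.
Proof. by move=> HF i l; apply: bnd_ext (HF i 0 l) => b j _; rewrite mxE. Qed.

End CubeBnd.

(* [phi] is a family of coordinates in which [N] lies between the sup norm and
   the 1-norm. *)
Definition coordnorm (R : realType) (U : zmodType) (N : U -> R) (E : finType)
    (phi : E -> U -> R) : Prop :=
  [/\ forall x u v, phi x (u - v) = phi x u - phi x v,
      forall x u, `|phi x u| <= N u &
      forall u, N u <= \sum_x `|phi x u|].

Lemma sqrt_sum_coord (R : realType) (E : finType) (f : E -> R) :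
  (forall x, `|f x| <= Num.sqrt (\sum_y f y ^+ 2)) /\
  Num.sqrt (\sum_y f y ^+ 2) <= \sum_y `|f y|.
Proof.
have s0 : 0 <= \sum_y `|f y| by exact: sumr_ge0.
split=> [x|].
  rewrite -sqrtr_sqr ler_wsqrtr// (bigD1 x)//= lerDl.
  by apply: sumr_ge0 => y _; exact: sqr_ge0.
rewrite -(ger0_norm s0) -sqrtr_sqr ler_wsqrtr//.
(* The sum of squares is at most the square of the sum, since the cross terms are nonnegative. *)
elim: (index_enum E) => [|x s IH]; first by rewrite !big_nil expr0n.
rewrite !big_cons sqrrD real_normK ?num_real// -addrA lerD2l.
rewrite (le_trans IH)// lerDr mulrn_wge0// mulr_ge0// sumr_ge0//.
Qed.

Lemma enorm_coord (R : realType) m n :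
  coordnorm (@enorm R m n) (fun x A => A x.1 x.2).
Proof.
have E (A : 'M[R]_(m, n)) : enorm A = Num.sqrt (\sum_x A x.1 x.2 ^+ 2).
  by rewrite /enorm pair_bigA.
split=> [x u v|x u|u]; first by rewrite !mxE.
  by rewrite E; have [+ _] := sqrt_sum_coord (fun x => u x.1 x.2); apply.
by rewrite E; have [_] := sqrt_sum_coord (fun x => u x.1 x.2).
Qed.

Lemma cnorm_coord (R : realType) d e :
  coordnorm (@cnorm R d e) (fun x A => A x.1 x.2.1 x.2.2).
Proof.
have E (A : cube R d e) : cnorm A = Num.sqrt (\sum_x A x.1 x.2.1 x.2.2 ^+ 2).
  rewrite /cnorm; under eq_bigr do rewrite pair_bigA; rewrite pair_bigA/=.
  by [].
split=> [x u v|x u|u]; first by rewrite !ffunE !mxE.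
  by rewrite E; have [+ _] := sqrt_sum_coord (fun x => u x.1 x.2.1 x.2.2); apply.
by rewrite E; have [_] := sqrt_sum_coord (fun x => u x.1 x.2.1 x.2.2).
Qed.

Lemma enorm_ge0 (R : realType) m n (A : 'M[R]_(m, n)) : 0 <= enorm A.
Proof. exact: sqrtr_ge0. Qed.

Lemma cnorm_ge0 (R : realType) d e (A : cube R d e) : 0 <= cnorm A.
Proof. exact: sqrtr_ge0. Qed.

(** * Hoelder seminorms as pointwise bounds *)

Lemma hld2_le (R : realType) (U : Type) (N : U -> R) (T eta K : R)
    (psi : R -> R -> U) :
  (hld2 N T eta psi <= K%:E)%E <->
  forall s t, 0 <= s -> s < t -> t <= T -> N (psi s t) <= K * (t - s) `^ eta.
Proof.
have p0 s t : s < t -> 0 < (t - s) `^ eta by move=> st; rewrite powR_gt0 ?subr_gt0.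
split=> [H s t s0 st tT|H].
  rewrite -ler_pdivrMr ?p0// -lee_fin (le_trans _ H)//.
  by apply: ereal_sup_ubound; exists (s, t).
apply: ge_ereal_sup => _ [[s t] /= [s0 [st tT]] <-].
by rewrite lee_fin ler_pdivrMr ?p0// H.
Qed.

(** [0 < T] provides a pair of times; over the empty set the supremum would be -oo. *)
Lemma hld2_ge0 (R : realType) (U : Type) (N : U -> R) (T eta : R)
    (psi : R -> R -> U) : 0 < T -> (forall u, 0 <= N u) ->
  (0 <= hld2 N T eta psi)%E.
Proof.
move=> T0 N0; apply: (@le_trans _ _ (N (psi 0 T) / (T - 0) `^ eta)%:E).
  by rewrite lee_fin divr_ge0// powR_ge0.
by apply: ereal_sup_ubound; exists (0, T) => //=.
Qed.

Lemma lee_sum3 (R : realType) (x y z : \bar R) (K : R) :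
  (0 <= x)%E -> (0 <= y)%E -> (0 <= z)%E -> (x + y + z <= K%:E)%E ->
  [/\ (x <= K%:E)%E, (y <= K%:E)%E & (z <= K%:E)%E].
Proof.
move=> x0 y0 z0 H; split; apply: le_trans H.
- by rewrite -addeA leeDl// adde_ge0.
- by rewrite [(x + y)%E]addeC -addeA leeDl// adde_ge0.
- by rewrite leeDr// adde_ge0.
Qed.

(** * Pairs of controlled rough paths *)

(** The data over which all estimates are uniform. [sD] is a free real number, required in
    [bounded_csys] to dominate the distance R, which may itself be infinite. *)
Record csys (R : realType) (d e : nat) := CSys {
  sX : bool -> rpath R d;
  sY : bool -> cpath R d e;
  sD : R }.

Definition bounded_csys (R : realType) (d e : nat) (T alpha M : R) (S : csys R d e) :=
  let: (X, Y, Y') := (sX S, sY S true, sY S false) in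
  [/\ forall b, ((enorm (cp0 (sY S b) 0) + enorm (cp1 (sY S b) 0)
        + cnorm (cp2 (sY S b) 0))%R%:E + cp_norm T alpha (X b) (sY S b) <= M%:E)%E,
      forall b, (rp_norm T alpha (X b) <= M%:E)%E &
      (rp_dist T alpha (X true) (X false)
       + (enorm (cp0 Y 0 - cp0 Y' 0) + enorm (cp1 Y 0 - cp1 Y' 0)
          + cnorm (cp2 Y 0 - cp2 Y' 0))%R%:E
       + cp_dist T alpha (X true) (X false) Y Y' <= (sD S)%:E)%E].

Section Systems.
Context (R : realType) (d e : nat) (T alpha M : R).
Hypotheses (T0 : 0 < T) (alpha0 : 0 < alpha).
Local Notation sys := (csys R d e).
Local Notation J := (sys * R * R)%type.

Definition sdom (j : J) :=
  [/\ bounded_csys T alpha M j.1.1, 0 <= j.1.2, j.1.2 < j.2 & j.2 <= T].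
Definition sscale (j : J) := (j.2 - j.1.2) `^ alpha.
Definition sdist (j : J) := sD j.1.1.

Local Notation sbnd := (bnd sdom sscale sdist).
Local Notation smbnd := (mbnd sdom sscale sdist).

Lemma bounded_csys_split (S : sys) : bounded_csys T alpha M S ->
  let X := sX S in let Y := sY S in
  [/\ forall b, [/\ enorm (cp0 (Y b) 0) <= M, enorm (cp1 (Y b) 0) <= M &
        cnorm (cp2 (Y b) 0) <= M],
      [/\ enorm (cp0 (Y true) 0 - cp0 (Y false) 0) <= sD S,
        enorm (cp1 (Y true) 0 - cp1 (Y false) 0) <= sD S &
        cnorm (cp2 (Y true) 0 - cp2 (Y false) 0) <= sD S],
      forall b, [/\ (cp_norm T alpha (X b) (Y b) <= M%:E)%E &
         (rp_norm T alpha (X b) <= M%:E)%E] &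
      [/\ (cp_dist T alpha (X true) (X false) (Y true) (Y false) <= (sD S)%:E)%E,
        (rp_dist T alpha (X true) (X false) <= (sD S)%:E)%E & 0 <= sD S]].
Proof.
have eg m n := @enorm_ge0 R m n; have cg := @cnorm_ge0 R d.
have h2 := hld2_ge0 _ _ T0.
have P0 (x y z : \bar R) : (0 <= x -> 0 <= y -> 0 <= z -> 0 <= x + y + z)%E.
  by move=> *; rewrite !adde_ge0.
move=> [HY HX HD] X Y.
have D3 := lee_sum3 _ _ _ HD.
have [|||D1 D2 D4] := D3; try by apply: P0; apply: h2.
  by rewrite lee_fin !addr_ge0.
have S3 (x y z K : R) : 0 <= x -> 0 <= y -> 0 <= z -> x + y + z <= K ->
  [/\ x <= K, y <= K & z <= K] by move=> *; split; lra.
split=> [b|| b|].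
- apply: S3 => //; rewrite -lee_fin (le_trans _ (HY b))// leeDl//.
  by apply: P0; apply: h2.
- by apply: S3 => //; rewrite -lee_fin.
- split; last exact: HX.
  by rewrite (le_trans _ (HY b))// leeDr// lee_fin !addr_ge0.
- split=> //; rewrite -lee_fin (le_trans _ D1)//; apply: P0; exact: h2.
Qed.

Lemma sscale_exp j k : sscale j ^+ k = (j.2 - j.1.2) `^ (k%:R * alpha).
Proof. by rewrite mulrC powRrM powR_mulrn// powR_ge0. Qed.

Lemma scale_sys : valid_scale sdom sscale sdist.
Proof.
split; first by move=> j _; exact: powR_ge0.
split=> [j [/bounded_csys_split[_ _ _ []]]//|].
exists (T `^ alpha) => j [_ s0 st tT].
rewrite /sscale; apply: ge0_ler_powR; first exact: ltW.
- by rewrite nnegrE subr_ge0 ltW.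
- by rewrite nnegrE ltW.
- by move: s0 st tT; lra.
Qed.

Lemma bnd_hld (U : zmodType) (N : U -> R) (E : finType) (phi : E -> U -> R)
    (F : sys -> bool -> R -> R -> U) (eta : R) k :
  coordnorm N phi -> eta = k%:R * alpha ->
  (forall S, bounded_csys T alpha M S ->
    (forall b, (hld2 N T eta (F S b) <= M%:E)%E) /\
    (hld2 N T eta (fun s t => F S true s t - F S false s t)%R
      <= (sD S)%:E)%E) ->
  forall x, sbnd k (fun b j => phi x (F j.1.1 b j.1.2 j.2)).
Proof.
(* In the constant, [|M|] serves the bound on each version and 1 the bound by [sD] on the
   difference. *)
move=> [phiB phiN _] -> HF x; exists (`|M| + 1) => [|[[S s] t] [gS /= s0 st tT]].
  by rewrite addr_ge0.
have [Hb Hd] := HF _ gS.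
have [_ _ _ [_ _ D0]] := bounded_csys_split gS.
have -> := sscale_exp (S, s, t) k.
have p0 := powR_ge0 (t - s) (k%:R * alpha).
split=> [b|].
  rewrite (le_trans (phiN _ _))//.
  have /hld2_le H := Hb b; rewrite (le_trans (H _ _ s0 st tT))// ler_wpM2r//.
  by have := ler_norm M; lra.
rewrite -phiB (le_trans (phiN _ _))//.
move/hld2_le : Hd => H; rewrite (le_trans (H _ _ s0 st tT))// ler_wpM2r//.
rewrite /sdist/= -[leLHS]mul1r ler_wpM2r//; have := normr_ge0 M; lra.
Qed.

(* The case s = 0 is apart: [sdom] then gives no bound on the increment. *)
Lemma bnd_path (F : sys -> bool -> R -> R) :
  (exists2 K, 0 <= K & forall S, bounded_csys T alpha M S ->
    (forall b, `|F S b 0| <= K) /\ `|F S true 0 - F S false 0| <= K * sD S) ->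
  sbnd 1 (fun b j => F j.1.1 b j.2 - F j.1.1 b j.1.2) ->
  sbnd 0 (fun b j => F j.1.1 b j.1.2).
Proof.
move=> [K K0 HK] [L L0 HL].
have [_ [D0 [A HA]]] := scale_sys.
exists (K + L * `|A|); first by rewrite addr_ge0// mulr_ge0.
move=> [[S s] t] [gS /= s0 st tT]; rewrite expr0 !mulr1.
have [h1 h2] := HK S gS.
have D0S : 0 <= sD S by have [_ _ _ []] := bounded_csys_split gS.
rewrite /sdist/=.
move: s0; rewrite le_eqVlt => /orP[/eqP <-|s0].
  split=> [b|]; first by rewrite (le_trans (h1 b))// lerDl mulr_ge0.
  by rewrite (le_trans h2)// ler_wpM2r// lerDl mulr_ge0.
(* The value at [s] is the value at 0 plus the increment over (0, s), whose scale is at most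
   [|A|]. *)
have dj : sdom (S, 0, s) by split=> //=; exact: le_trans (ltW st) tT.
have [g1 g2] := HL _ dj; rewrite expr1 /= in g1 g2.
have aA : sscale (S, 0, s) <= `|A| by rewrite (le_trans (HA _ dj))// ler_norm.
split=> [b|].
  rewrite -[F S b s](subrK (F S b 0)) addrC (le_trans (ler_normD _ _))// lerD//.
  by rewrite (le_trans (g1 b))// ler_wpM2l.
have -> : F S true s - F S false s = (F S true 0 - F S false 0) +
  ((F S true s - F S true 0) - (F S false s - F S false 0)) by ring.
rewrite (le_trans (ler_normD _ _))// mulrDl lerD//.
rewrite (le_trans g2)// [leRHS]mulrAC ler_wpM2l// mulr_ge0//.
Qed.

Lemma mbnd_path m n (F : sys -> bool -> R -> 'M[R]_(m, n)) :
  (forall S, bounded_csys T alpha M S -> (forall b, enorm (F S b 0) <= M) /\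
    enorm (F S true 0 - F S false 0) <= sD S) ->
  smbnd 1 (fun b j => F j.1.1 b j.2 - F j.1.1 b j.1.2) ->
  smbnd 0 (fun b j => F j.1.1 b j.1.2).
Proof.
move=> H0 HF i l; apply: (@bnd_path (fun S b t => F S b t i l)); last first.
  by apply: bnd_ext (HF i l) => b j _; rewrite !mxE.
exists (`|M| + 1) => [|S gS]; first by rewrite addr_ge0.
have [h1 h2] := H0 S gS; have [eB eN _] := enorm_coord R m n.
have [_ _ _ [_ _ D0]] := bounded_csys_split gS.
split=> [b|].
  rewrite (le_trans (eN (i, l) _))// (le_trans (h1 b))//.
  by have := ler_norm M; lra.
have := eN (i, l) (F S true 0 - F S false 0); rewrite (eB (i, l))/= => h.
rewrite (le_trans h)// (le_trans h2)// -[leLHS]mul1r ler_wpM2r//.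
by have := normr_ge0 M; lra.
Qed.

(** Converse of [bnd_hld], with the constants of the coordinates summed because [N] is below the
    1-norm. [G] carries an extra condition on the pair: geometricity for Z^sharp, [True]
    otherwise. *)
Lemma hld_bnd (U : zmodType) (N : U -> R) (E : finType) (phi : E -> U -> R)
    (F : sys -> bool -> R -> R -> U) (eta : R) k (G : sys -> Prop) :
  coordnorm N phi -> eta = k%:R * alpha ->
  (forall x, bnd (fun j => sdom j /\ G j.1.1) sscale sdist k
    (fun b j => phi x (F j.1.1 b j.1.2 j.2))) ->
  exists2 K, 0 <= K & forall S, bounded_csys T alpha M S -> G S ->
    (forall b, (hld2 N T eta (F S b) <= K%:E)%E) /\
    (hld2 N T eta (fun s t => F S true s t - F S false s t)%R
      <= (K * sD S)%:E)%E.
Proof.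
move=> [phiB _ phiN] -> HF.
have /choice[K HK] : forall x, exists K, 0 <= K /\ forall j, sdom j /\ G j.1.1 ->
    (forall b, `|phi x (F j.1.1 b j.1.2 j.2)| <= K * sscale j ^+ k) /\
    `|phi x (F j.1.1 true j.1.2 j.2) - phi x (F j.1.1 false j.1.2 j.2)|
      <= K * sdist j * sscale j ^+ k.
  by move=> x; have [K K0 HK] := HF x; exists K.
exists (\sum_x K x); first by apply: sumr_ge0 => x _; have [] := HK x.
move=> S gS GS; split=> [b|]; apply/hld2_le => s t s0 st tT;
    have dj : sdom (S, s, t) /\ G S by [].
  have <- := sscale_exp (S, s, t) k.
  rewrite (le_trans (phiN _))// mulr_suml ler_sum// => x _.
  by have [_ /(_ _ dj)[+ _]] := HK x; apply.
have <- := sscale_exp (S, s, t) k.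
rewrite (le_trans (phiN _))// -mulrA mulr_suml ler_sum// => x _.
by have [_ /(_ _ dj)[_]] := HK x; rewrite phiB mulrA.
Qed.

End Systems.

(* [L], [L'] and [H], [H'] stand for the first and second derivatives at the two
   endpoints, [H w v] for [hessian _ _ v w]. *)
Section Expansions.
Context (R : realType) (d e e' : nat).
Context (L L' : {linear 'rV[R]_e -> 'rV[R]_e'}).
Context (H H' : 'rV[R]_e -> {linear 'rV[R]_e -> 'rV[R]_e'}).
Hypothesis HDr : forall v w w', H (w + w') v = H w v + H w' v.
Hypothesis HZr : forall k v w, H (k *: w) v = k *: H w v.
Implicit Types (v w h : 'rV[R]_e) (y : 'M[R]_(d, e)) (A : cube R d e).
Local Notation dZ1 L y := (\matrix_(i < d) L (row i y)).
Local Notation dZ2 y A := ([ffun i => \matrix_(j < d)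
  (L (row j (A i)) + H (row j y) (row i y))] : cube R d e').

Lemma linear_incr_split v v' : (L' v' - L v') + L (v' - v) = L' v' - L v.
Proof. by rewrite linearB addrA subrK. Qed.

(** The base point, [v] and [w] are changed one at a time. *)
Lemma bilinear_incr_split v v' w w' :
  (H' w' v' - H w' v') + H w' (v' - v) + H (w' - w) v = H' w' v' - H w v.
Proof.
have -> : H (w' - w) v = H w' v - H w v.
  by rewrite HDr -scaleN1r HZr scaleN1r.
by rewrite linearB !addrA !subrK.
Qed.

Lemma bilinear_sumr v (I : finType) (k : I -> R) (w : I -> 'rV[R]_e) :
  H (\sum_i k i *: w i) v = \sum_i k i *: H (w i) v.
Proof.
suff E (s : seq I) : H (\sum_(i <- s) k i *: w i) v =
  \sum_(i <- s) k i *: H (w i) v by [].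
elim: s => [|i s IH]; last by rewrite !big_cons HDr HZr IH.
by rewrite !big_nil -[0 in LHS](scale0r 0) HZr scale0r.
Qed.

Lemma linear_sumZ (K : {linear 'rV[R]_e -> 'rV[R]_e'}) (I : finType)
    (k : I -> R) (v : I -> 'rV[R]_e) :
  K (\sum_i k i *: v i) = \sum_i k i *: K (v i).
Proof. by rewrite linear_sum; apply: eq_bigr => i _; rewrite linearZ. Qed.

(** The terms linear in [x] cancel. What remains is a second-order Taylor remainder of the
    derivative, a product of two first-order increments, and the corrections [r1] and [q2], which
    have order 2. *)
Lemma rem1_split h (x : 'rV[R]_d) y y' r1 A q2 (k : 'I_d) :
  y' - y = cube_app1 A x + r1 -> h = x *m y + q2 ->
  row k (dZ1 L' y' - dZ1 L y - cube_app1 (dZ2 y A) x) =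
  (L' (row k y) - L (row k y) - H (row k y) h)
  + (L' (row k (y' - y)) - L (row k (y' - y)))
  + (L (row k r1) + H (row k y) q2).
Proof.
move=> Hy Hq.
have -> : row k (dZ1 L' y' - dZ1 L y - cube_app1 (dZ2 y A) x) =
    L' (row k y') - L (row k y) -
    (\sum_i x 0 i *: L (row k (A i)) +
     \sum_i x 0 i *: H (row k y) (row i y)).
  rewrite 2!(linearB (row k))/= row_cube_app1 !rowK -big_split; congr (_ - _).
  by apply: eq_bigr => i _; rewrite ffunE rowK/= scalerDr.
have -> : L' (row k (y' - y)) = L' (row k y') - L' (row k y).
  by rewrite (linearB (row k)) (linearB L').
have -> : L (row k (y' - y)) =
    \sum_i x 0 i *: L (row k (A i)) + L (row k r1).
  by rewrite Hy (linearD (row k)) (linearD L)/= row_cube_app1 linear_sumZ.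
have -> : H (row k y) h =
    \sum_i x 0 i *: H (row k y) (row i y) + H (row k y) q2.
  by rewrite Hq linearD mulmx_sum_row linear_sumZ.
move: (L' _) (L _) (L' _) (L _) (\sum_i _) (\sum_i _) (H _ _).
move=> u1 u2 u3 u4 u5 u6 u7; apply/rowP => c; rewrite !mxE; ring.
Qed.

Hypothesis Hsym : forall v w, H v w = H w v.

(** As [H] is symmetric, transposing [X] leaves the sum unchanged, so only the symmetric part of [X]
    contributes, and this part is half of x (x) x. *)
Lemma sum_bilinear_geometric (x : 'rV[R]_d) y (X : 'M[R]_d) :
  (forall i j, X i j + X j i = x 0 i * x 0 j) ->
  \sum_i \sum_j X i j *: H (row j y) (row i y) =
  2^-1 *: H (x *m y) (x *m y).
Proof.
move=> HX.
have -> : H (x *m y) (x *m y) =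
    \sum_i \sum_j (x 0 i * x 0 j) *: H (row j y) (row i y).
  rewrite {2}mulmx_sum_row linear_sumZ; apply: eq_bigr => i _.
  rewrite mulmx_sum_row bilinear_sumr scaler_sumr; apply: eq_bigr => j _.
  by rewrite scalerA.
have -> : \sum_i \sum_j (x 0 i * x 0 j) *: H (row j y) (row i y) =
    \sum_i \sum_j X i j *: H (row j y) (row i y) +
    \sum_i \sum_j X j i *: H (row j y) (row i y).
  rewrite -big_split; apply: eq_bigr => i _; rewrite -big_split.
  by apply: eq_bigr => j _; rewrite -HX scalerDl.
have -> : \sum_i \sum_j X j i *: H (row j y) (row i y) =
    \sum_i \sum_j X i j *: H (row j y) (row i y).
  rewrite exchange_big; apply: eq_bigr => i _; apply: eq_bigr => j _.
  by rewrite Hsym.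
have half : 2^-1 + 2^-1 = 1 :> R by field.
by rewrite scalerDr -scalerDl half scale1r.
Qed.

(** By [sum_bilinear_geometric] the Hessian part of the [X] term is half of [H] on (x y, x y). With
    h = x y + q2, its difference from half of [H h h] consists of terms with one factor [q2], of
    order 2, and one factor of order 1. *)
Lemma rem0_split (u u' : 'rV[R]_e') h (x : 'rV[R]_d) y A (X : 'M[R]_d) r0 :
  (forall i j, X i j + X j i = x 0 i * x 0 j) ->
  h = x *m y + (cube_app2 A X + r0) ->
  u' - u - x *m dZ1 L y - cube_app2 (dZ2 y A) X =
  (u' - u - L h - 2^-1 *: H h h)
  + (L r0 + 2^-1 *: (H (cube_app2 A X + r0) (x *m y)
                     + H h (cube_app2 A X + r0))).
Proof.
move=> HX Hq; set q2 := cube_app2 A X + r0 in Hq *.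
have -> : x *m dZ1 L y = L (x *m y).
  rewrite !mulmx_sum_row linear_sumZ.
  by apply: eq_bigr => i _; rewrite rowK.
have -> : cube_app2 (dZ2 y A) X =
    L (cube_app2 A X) + 2^-1 *: H (x *m y) (x *m y).
  rewrite -(sum_bilinear_geometric y HX).
  have -> : L (cube_app2 A X) = \sum_i \sum_j X i j *: L (row j (A i)).
    by rewrite linear_sum; apply: eq_bigr => i _; exact: linear_sumZ.
  rewrite -big_split; apply: eq_bigr => i _; rewrite -big_split.
  by apply: eq_bigr => j _; rewrite ffunE rowK scalerDr.
have -> : H h h = H (x *m y) (x *m y) + (H q2 (x *m y) + H h q2).
  rewrite {2}Hq (linearD (H h)) {1}Hq HDr.
  by rewrite addrA.
have -> : L h = L (x *m y) + (L (cube_app2 A X) + L r0).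
  by rewrite Hq !linearD.
move: (H _ _ + _) (H _ _) => h1 h2.
move: (L _) (L _) (L _) => u1 u2 u3.
apply/rowP => c; rewrite !mxE; ring.
Qed.

End Expansions.

(** Puts the seminorm of a difference of paths in the two-parameter form of [bnd_hld] and
    [hld_bnd]. *)
Lemma hld1B (R : realType) (U : zmodType) (N : U -> R) (T eta : R)
    (f g : R -> U) :
  hld1 N T eta (fun t => f t - g t) =
  hld2 N T eta (fun s t => (f t - f s) - (g t - g s)).
Proof.
rewrite /hld1; congr (hld2 _ _ _ _); apply/funext => s; apply/funext => t.
by rewrite !opprD !opprK addrACA.
Qed.

Lemma enorm_cube_le (R : realType) d e (A : cube R d e) i : enorm (A i) <= cnorm A.
Proof.
rewrite ler_wsqrtr// [leRHS](bigD1 i)//= lerDl; apply: sumr_ge0 => j _.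
by apply: sumr_ge0 => k _; apply: sumr_ge0 => l _; exact: sqr_ge0.
Qed.

(** * Orders of the composed path *)

Section Main.
Context (R : realType) (d e e' : nat) (T alpha M : R).
Hypotheses (T0 : 0 < T) (alpha0 : 0 < alpha).
Context (Phi : 'rV[R]_e -> 'rV[R]_e') (HPhi : classC 4 Phi).
Local Notation sys := (csys R d e).
Local Notation J := (sys * R * R)%type.
Local Notation smbnd := (mbnd (@sdom R d e T alpha M) (@sscale R d e alpha)
  (@sdist R d e)).
Local Notation X1 := (fun b (j : J) => lvl1 (sX j.1.1 b) j.1.2 j.2).
Local Notation X2 := (fun b (j : J) => lvl2 (sX j.1.1 b) j.1.2 j.2).
Local Notation Y0s := (fun b (j : J) => cp0 (sY j.1.1 b) j.1.2).
Local Notation Y1s := (fun b (j : J) => cp1 (sY j.1.1 b) j.1.2).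
Local Notation Y2s := (fun b (j : J) => cp2 (sY j.1.1 b) j.1.2).
Local Notation dY0 :=
  (fun b (j : J) => cp0 (sY j.1.1 b) j.2 - cp0 (sY j.1.1 b) j.1.2).
Local Notation dY1 :=
  (fun b (j : J) => cp1 (sY j.1.1 b) j.2 - cp1 (sY j.1.1 b) j.1.2).
Local Notation R0 :=
  (fun b (j : J) => rem0 (sX j.1.1 b) (sY j.1.1 b) j.1.2 j.2).
Local Notation R1 :=
  (fun b (j : J) => rem1 (sX j.1.1 b) (sY j.1.1 b) j.1.2 j.2).

Let Hs := @scale_sys R d e T alpha M T0 alpha0.

Lemma bounded_csys_hld (S : sys) : bounded_csys T alpha M S ->
  let X := sX S in let Y := sY S in
  [/\ forall b,
      [/\ (hld2 (@enorm R 1 d) T alpha (lvl1 (X b)) <= M%:E)%E,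
          (hld2 (@enorm R d d) T (2 * alpha) (lvl2 (X b)) <= M%:E)%E,
          (hld1 (@cnorm R d e) T alpha (cp2 (Y b)) <= M%:E)%E,
          (hld2 (@enorm R 1 e) T (3 * alpha) (rem0 (X b) (Y b)) <= M%:E)%E &
          (hld2 (@enorm R d e) T (2 * alpha) (rem1 (X b) (Y b)) <= M%:E)%E] &
      [/\ (hld2 (@enorm R 1 d) T alpha
            (fun s t => lvl1 (X true) s t - lvl1 (X false) s t)%R
            <= (sD S)%:E)%E,
          (hld2 (@enorm R d d) T (2 * alpha)
            (fun s t => lvl2 (X true) s t - lvl2 (X false) s t)%R
            <= (sD S)%:E)%E,
          (hld1 (@cnorm R d e) T alpha
            (fun t => cp2 (Y true) t - cp2 (Y false) t)%R <= (sD S)%:E)%E,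
          (hld2 (@enorm R 1 e) T (3 * alpha)
            (fun s t => rem0 (X true) (Y true) s t
              - rem0 (X false) (Y false) s t)%R <= (sD S)%:E)%E &
          (hld2 (@enorm R d e) T (2 * alpha)
            (fun s t => rem1 (X true) (Y true) s t
              - rem1 (X false) (Y false) s t)%R <= (sD S)%:E)%E]].
Proof.
have eg m n := @enorm_ge0 R m n; have cg d' e'' := @cnorm_ge0 R d' e''.
have h2 := hld2_ge0 _ _ T0.
move=> gS X Y; have [_ _ Hb [HYd HXd _]] := bounded_csys_split T0 gS.
split=> [b|].
  have [HY HX] := Hb b.
  by have [|||? ? ?] := lee_sum3 _ _ _ HY; try (by apply: h2);
     have [|||? ? ?] := lee_sum3 _ _ _ HX; try (by apply: h2).
by have [|||? ? ?] := lee_sum3 _ _ _ HYd; try (by apply: h2);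
   have [|||? ? ?] := lee_sum3 _ _ _ HXd; try (by apply: h2).
Qed.

Lemma mbnd_lvl1 : smbnd 1 X1.
Proof.
move=> i l; apply: (bnd_hld (k := 1) (F := fun (S : sys) b => lvl1 (sX S b)) T0
  (@enorm_coord R 1 d) (esym (mul1r alpha)) _ (i, l)) => S /bounded_csys_hld[Hb [Hd *]].
by split=> // b; have [] := Hb b.
Qed.

Lemma mbnd_lvl2 : smbnd 2 X2.
Proof.
move=> i l; apply: (bnd_hld (F := fun (S : sys) b => lvl2 (sX S b)) T0
  (@enorm_coord R d d) erefl _ (i, l)) => S /bounded_csys_hld[Hb [_ Hd *]].
by split=> // b; have [] := Hb b.
Qed.

Lemma mbnd_rem0 : smbnd 3 R0.
Proof.
move=> i l; apply: (bnd_hld (F := fun (S : sys) b => rem0 (sX S b) (sY S b)) T0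
  (@enorm_coord R 1 e) erefl _ (i, l)) => S /bounded_csys_hld[Hb [_ _ _ Hd *]].
by split=> // b; have [] := Hb b.
Qed.

Lemma mbnd_rem1 : smbnd 2 R1.
Proof.
move=> i l; apply: (bnd_hld (F := fun (S : sys) b => rem1 (sX S b) (sY S b)) T0
  (@enorm_coord R d e) erefl _ (i, l)) => S /bounded_csys_hld[Hb [_ _ _ _ Hd]].
by split=> // b; have [] := Hb b.
Qed.

Lemma mbnd_incr2 i : smbnd 1
  (fun b j => cp2 (sY j.1.1 b) j.2 i - cp2 (sY j.1.1 b) j.1.2 i).
Proof.
move=> k l; apply: bnd_ext (bnd_hld (k := 1)
  (F := fun (S : sys) b s t => cp2 (sY S b) t - cp2 (sY S b) s) T0
  (@cnorm_coord R d e) (esym (mul1r alpha)) _ (i, (k, l))) => [b j _|S gS].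
  by rewrite !ffunE.
have [Hb [_ _ Hd _ _]] := bounded_csys_hld gS.
by rewrite -hld1B; split=> // b; have [] := Hb b.
Qed.

(** Start of a descent: the order of Y^dagdag gives that of the increments of Y^dag, hence of Y^dag,
    then of the increments of Y, hence of Y. *)
Lemma mbnd_cp2 i : smbnd 0 (fun b j => cp2 (sY j.1.1 b) j.1.2 i).
Proof.
apply: (mbnd_path T0 alpha0 (F := fun (S : sys) b t => cp2 (sY S b) t i)) (mbnd_incr2 i).
move=> S /(bounded_csys_split T0)[Hb [_ _ Hd] _ _]; split=> [b|].
  by have [_ _ h] := Hb b; exact: le_trans (enorm_cube_le _ _) h.
apply: le_trans Hd; apply: le_trans (enorm_cube_le _ i).
by rewrite !ffunE.
Qed.

Lemma incr1E b j : dY1 b j = cube_app1 (Y2s b j) (X1 b j) + R1 b j.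
Proof. by rewrite /rem1 [RHS]addrC subrK. Qed.

Lemma mbnd_incr1 : smbnd 1 dY1.
Proof.
apply: mbnd_ext (fun b j _ => esym (incr1E b j)) _.
apply: mbndD; last exact: mbnd_le mbnd_rem1.
exact: (mbnd_cube_app1 Hs mbnd_cp2 mbnd_lvl1).
Qed.

Lemma mbnd_cp1 : smbnd 0 Y1s.
Proof.
apply: (mbnd_path T0 alpha0 (F := fun (S : sys) b t => cp1 (sY S b) t)) mbnd_incr1.
move=> S /(bounded_csys_split T0)[Hb [_ Hd _] _ _]; split=> // b.
by have [] := Hb b.
Qed.

Lemma incr0E b j : dY0 b j = X1 b j *m Y1s b j +
  (cube_app2 (Y2s b j) (X2 b j) + R0 b j).
Proof. by rewrite /rem0 [cube_app2 _ _ + _]addrC subrK [RHS]addrC subrK. Qed.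

(** The increment of Y beyond its term linear in X^1; this is the [q2] of [rem1_split] and
    [rem0_split]. *)
Lemma mbnd_order2 :
  smbnd 2 (fun b j => cube_app2 (Y2s b j) (X2 b j) + R0 b j).
Proof.
apply: mbndD; last exact: mbnd_le mbnd_rem0.
exact: (mbnd_cube_app2 Hs mbnd_cp2 mbnd_lvl2).
Qed.

Lemma mbnd_incr0 : smbnd 1 dY0.
Proof.
apply: mbnd_ext (fun b j _ => esym (incr0E b j)) _.
apply: mbndD; last exact: mbnd_le mbnd_order2.
exact: (mbnd_mul Hs mbnd_lvl1 mbnd_cp1).
Qed.

Lemma mbnd_cp0 : smbnd 0 Y0s.
Proof.
apply: (mbnd_path T0 alpha0 (F := fun (S : sys) b t => cp0 (sY S b) t)) mbnd_incr0.
move=> S /(bounded_csys_split T0)[Hb [Hd _ _] _ _]; split=> // b.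
by have [] := Hb b.
Qed.

(** [bnd_path] bounds a path at the left endpoint; the right endpoint is reached by adding the
    increment. *)
Lemma mbnd_endpoint m n (p q : bool -> J -> 'M[R]_(m, n)) : smbnd 0 p ->
  smbnd 1 (fun b j => q b j - p b j) -> smbnd 0 q.
Proof.
move=> Hp Hpq; apply: mbnd_ext (mbndD Hp (mbnd_le Hs (leq0n 1) Hpq)) => b j _.
by rewrite subrKC.
Qed.

Local Notation Y0t := (fun b (j : J) => cp0 (sY j.1.1 b) j.2).
Local Notation Y1t := (fun b (j : J) => cp1 (sY j.1.1 b) j.2).
Local Notation Z := (fun b (j : J) => cp_comp Phi (sY j.1.1 b)).

Let HPhi3 : classC 3 Phi. Proof. exact: classC_weak. Qed.
Let HPhi2 : classC 2 Phi. Proof. exact: classC_weak. Qed.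
Let HDr p v w w' : hessian Phi p v (w + w') = hessian Phi p v w + hessian Phi p v w'.
Proof. exact: hessianDr. Qed.
Let HZr p k v w : hessian Phi p v (k *: w) = k *: hessian Phi p v w.
Proof. exact: hessianZr. Qed.

Lemma mbnd_incr0_comp : smbnd 1 (fun b j => cp0 (Z b j) j.2 - cp0 (Z b j) j.1.2).
Proof. exact: (taylor1_incr Hs mbnd_cp0 mbnd_incr0 HPhi2). Qed.

Lemma mbnd_diff_incr (v v' : bool -> J -> 'rV[R]_e) :
  smbnd 0 v -> smbnd 1 (fun b j => v' b j - v b j) ->
  smbnd 1 (fun b j => 'd Phi (Y0t b j) (v' b j) - 'd Phi (Y0s b j) (v b j)).
Proof.
move=> Hv Hd; have Hv' := mbnd_endpoint Hv Hd.
have A := bnd_diff_incr Hs mbnd_cp0 mbnd_incr0 HPhi3 Hv'.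
have B := bnd_diff Hs HPhi2 mbnd_cp0 Hd.
apply: mbnd_ext (mbndD A B) => b j _; exact: linear_incr_split.
Qed.

Lemma mbnd_hessian_incr (v v' w w' : bool -> J -> 'rV[R]_e) :
  smbnd 0 v -> smbnd 1 (fun b j => v' b j - v b j) ->
  smbnd 0 w -> smbnd 1 (fun b j => w' b j - w b j) ->
  smbnd 1 (fun b j => hessian Phi (Y0t b j) (v' b j) (w' b j)
                     - hessian Phi (Y0s b j) (v b j) (w b j)).
Proof.
move=> Hv Hdv Hw Hdw; have Hv' := mbnd_endpoint Hv Hdv; have Hw' := mbnd_endpoint Hw Hdw.
have A := bnd_hessian_incr Hs mbnd_cp0 mbnd_incr0 HPhi Hv' Hw'.
have B := bnd_hessian Hs HPhi3 mbnd_cp0 Hdv Hw'.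
have C := bnd_hessian Hs HPhi3 mbnd_cp0 Hv Hdw.
apply: mbnd_ext (mbndD (mbndD A B) C) => b j _.
exact: (bilinear_incr_split
  (H := fun w => 'd (fun y => 'd Phi y w) (Y0s b j))
  (fun w => 'd (fun y => 'd Phi y w) (Y0t b j))
  (fun v w w' => HDr (Y0s b j) v w w') (fun k v w => HZr (Y0s b j) k v w)).
Qed.

Lemma mbnd_row_incr m n (p q : bool -> J -> 'M[R]_(m, n)) k :
  smbnd 1 (fun b j => q b j - p b j) ->
  smbnd 1 (fun b j => row k (q b j) - row k (p b j)).
Proof.
by move=> H; apply: mbnd_ext (mbnd_row k H) => b j _; exact: linearB.
Qed.

Lemma mbnd_incr1_comp : smbnd 1 (fun b j => cp1 (Z b j) j.2 - cp1 (Z b j) j.1.2).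
Proof.
apply: mbnd_rows => k.
apply: mbnd_ext (mbnd_diff_incr (mbnd_row k mbnd_cp1) (mbnd_row_incr k mbnd_incr1)) => b j _.
by rewrite linearB/= !rowK.
Qed.

Lemma mbnd_incr2_comp i :
  smbnd 1 (fun b j => cp2 (Z b j) j.2 i - cp2 (Z b j) j.1.2 i).
Proof.
apply: mbnd_rows => k.
have HL := mbnd_diff_incr (mbnd_row k (mbnd_cp2 i)) (mbnd_row_incr k (mbnd_incr2 i)).
have HH := mbnd_hessian_incr (mbnd_row i mbnd_cp1) (mbnd_row_incr i mbnd_incr1)
  (mbnd_row k mbnd_cp1) (mbnd_row_incr k mbnd_incr1).
apply: mbnd_ext (mbndD HL HH) => b j _.
by rewrite linearB/= !ffunE !rowK opprD addrACA.
Qed.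

(** [A], [B], [C], [D] are the terms of [rem1_split], of orders 2 + 0, 1 + 1, 2 and 2 + 0. *)
Lemma mbnd_rem1_comp : smbnd 2 (fun b j => rem1 (sX j.1.1 b) (Z b j) j.1.2 j.2).
Proof.
apply: mbnd_rows => k.
have A := bnd_diff_taylor Hs mbnd_cp0 mbnd_incr0 HPhi (mbnd_row k mbnd_cp1).
have B := bnd_diff_incr Hs mbnd_cp0 mbnd_incr0 HPhi3 (mbnd_row k mbnd_incr1).
have C := bnd_diff Hs HPhi2 mbnd_cp0 (mbnd_row k mbnd_rem1).
have D := bnd_hessian Hs HPhi3 mbnd_cp0 mbnd_order2 (mbnd_row k mbnd_cp1).
apply: mbnd_ext (mbndD (mbndD A B) (mbndD C D)) => b j _; apply: esym.
exact: (rem1_split ('d Phi (Y0s b j)) ('d Phi (Y0t b j))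
  (fun w => 'd (fun y => 'd Phi y w) (Y0s b j)) k (incr1E b j) (incr0E b j)).
Qed.

Definition geometric_sdom (j : J) := sdom T alpha M j /\ forall b, geometric2 T (sX j.1.1 b).

Lemma mbnd_rem0_comp : mbnd geometric_sdom (@sscale R d e alpha) (@sdist R d e) 3
  (fun b j => rem0 (sX j.1.1 b) (Z b j) j.1.2 j.2).
Proof.
have A := taylor3_incr Hs mbnd_cp0 mbnd_incr0 HPhi.
have B := bnd_diff Hs HPhi2 mbnd_cp0 mbnd_rem0.
have HX := mbnd_mul Hs mbnd_lvl1 mbnd_cp1.
have C := bnd_hessian Hs HPhi3 mbnd_cp0 HX mbnd_order2.
have D := bnd_hessian Hs HPhi3 mbnd_cp0 mbnd_order2 mbnd_incr0.
(* The orders are 3 for [A] and [B], 1 + 2 for [C] and 2 + 1 for [D], all on [sdom]; the restriction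
   to [geometric_sdom] prepares the identity [rem0_split]. *)
have E : smbnd 3 _ := mbndD A (mbndD B (mbndZ Hs (bnd_cst Hs 2^-1) (mbndD C D))).
have F := mbnd_sub (P' := geometric_sdom) (pi := id)
  (fun j H => And3 (proj1 H) erefl erefl) E.
apply: mbnd_ext F => b [[S s] t] [[_ /= s0 st tT] geo]; apply: esym.
apply: (rem0_split ('d Phi (Y0s b (S, s, t)))
  (H := fun w => 'd (fun y => 'd Phi y w) (Y0s b (S, s, t)))).
- exact: HDr.
- exact: HZr.
- by move=> v w; apply: hessian_sym.
- by move=> i j; apply: geo => //; exact: ltW.
- exact: (incr0E b (S, s, t)).
Qed.

End Main.

(** * From orders back to Hoelder bounds on Z *)

Lemma coordnorm_subrr (R : realType) (U : zmodType) (N : U -> R) (E : finType)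
    (phi : E -> U -> R) u : coordnorm N phi -> N (u - u) <= 0.
Proof.
move=> [phiB _ phiN]; rewrite (le_trans (phiN _))// big1// => x _.
by rewrite phiB subrr normr0.
Qed.

Lemma hld2_subrr (R : realType) (U : zmodType) (N : U -> R) (E : finType)
    (phi : E -> U -> R) (T eta : R) (psi : R -> R -> U) : coordnorm N phi ->
  (hld2 N T eta (fun s t => psi s t - psi s t)%R <= 0)%E.
Proof.
move=> HN; apply/hld2_le => s t _ _ _; rewrite mul0r.
exact: coordnorm_subrr HN.
Qed.

(* Comparing a controlled rough path with itself, at distance 0, yields the
   absolute bounds on Z even when the distance in the theorem is infinite. *)
Lemma bounded_csys_diag (R : realType) d e (T alpha M : R) (X : rpath R d)
    (Y : cpath R d e) :
  ((enorm (cp0 Y 0) + enorm (cp1 Y 0) + cnorm (cp2 Y 0))%R%:E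
     + cp_norm T alpha X Y <= M%:E)%E ->
  (rp_norm T alpha X <= M%:E)%E ->
  bounded_csys T alpha M (CSys (fun=> X) (fun=> Y) 0).
Proof.
move=> HY HX; split=> //=.
have h2 U N := @hld2_subrr R U N.
have e0 m n (A : 'M[R]_(m, n)) : enorm (A - A) <= 0.
  exact: coordnorm_subrr (@enorm_coord R m n).
have c0 (A : cube R d e) : cnorm (A - A) <= 0.
  exact: coordnorm_subrr (@cnorm_coord R d e).
rewrite /rp_dist /cp_dist hld1B.
have ez m n := @enorm_coord R m n; have cz d' e' := @cnorm_coord R d' e'.
have P3 (x y z : \bar R) : (x <= 0 -> y <= 0 -> z <= 0 -> x + y + z <= 0)%E.
  by move=> x0 y0 z0; rewrite !adde_le0.
apply: (P3); last by apply: (P3); apply: h2.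
  by apply: (P3); apply: h2.
rewrite lee_fin; move: (e0 _ _ (cp0 Y 0)) (e0 _ _ (cp1 Y 0)) (c0 (cp2 Y 0)).
lra.
Qed.

Section Final.
Context (R : realType) (d e e' : nat) (T alpha M : R).
Hypotheses (T0 : 0 < T) (alpha0 : 0 < alpha).
Context (Phi : 'rV[R]_e -> 'rV[R]_e') (HPhi : classC 4 Phi).
Local Notation sys := (csys R d e).
Local Notation Z := (fun (S : sys) b => cp_comp Phi (sY S b)).
Local Notation geo := (fun S : sys => forall b, geometric2 T (sX S b)).

Lemma mbnd_restr k m n (G : sys -> Prop) (F : bool -> sys * R * R -> 'M[R]_(m, n)) :
  mbnd (@sdom R d e T alpha M) (@sscale R d e alpha) (@sdist R d e) k F ->
  mbnd (fun j => sdom T alpha M j /\ G j.1.1) (@sscale R d e alpha)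
    (@sdist R d e) k F.
Proof. by apply: (mbnd_sub (pi := id)) => j []. Qed.

Lemma hld_incr0_comp : exists2 K, 0 <= K & forall S : sys, bounded_csys T alpha M S ->
  (forall b, (hld1 (@enorm R 1 e') T alpha (cp0 (Z S b)) <= K%:E)%E) /\
  (hld1 (@enorm R 1 e') T alpha (fun t => cp0 (Z S true) t - cp0 (Z S false) t)%R
    <= (K * sD S)%:E)%E.
Proof.
have [x|K K0 HK] := @hld_bnd R d e T alpha M _ _ _ _
  (fun S b s t => cp0 (Z S b) t - cp0 (Z S b) s) alpha 1 (fun=> True)
  (@enorm_coord R 1 e') (esym (mul1r alpha)).
  exact: (mbnd_restr (fun=> True) (mbnd_incr0_comp d M T0 alpha0 HPhi) x.1 x.2).
by exists K => // S gS; rewrite hld1B; exact: HK.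
Qed.

Lemma hld_incr1_comp : exists2 K, 0 <= K & forall S : sys, bounded_csys T alpha M S ->
  (forall b, (hld1 (@enorm R d e') T alpha (cp1 (Z S b)) <= K%:E)%E).
Proof.
have [x|K K0 HK] := @hld_bnd R d e T alpha M _ _ _ _
  (fun S b s t => cp1 (Z S b) t - cp1 (Z S b) s) alpha 1 (fun=> True)
  (@enorm_coord R d e') (esym (mul1r alpha)).
  exact: (mbnd_restr (fun=> True) (mbnd_incr1_comp M T0 alpha0 HPhi) x.1 x.2).
by exists K => // S gS; have [] := HK S gS I.
Qed.

Lemma hld_incr2_comp : exists2 K, 0 <= K & forall S : sys, bounded_csys T alpha M S ->
  (forall b, (hld1 (@cnorm R d e') T alpha (cp2 (Z S b)) <= K%:E)%E) /\
  (hld1 (@cnorm R d e') T alpha (fun t => cp2 (Z S true) t - cp2 (Z S false) t)%R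
    <= (K * sD S)%:E)%E.
Proof.
have [[i [k l]]|K K0 HK] := @hld_bnd R d e T alpha M _ _ _ _
  (fun S b s t => cp2 (Z S b) t - cp2 (Z S b) s) alpha 1 (fun=> True)
  (@cnorm_coord R d e') (esym (mul1r alpha)).
  apply: bnd_ext (mbnd_restr (fun=> True) (mbnd_incr2_comp M T0 alpha0 HPhi i) k l) => b j _.
  by rewrite !ffunE.
by exists K => // S gS; rewrite hld1B; exact: HK.
Qed.

Lemma hld_rem1_comp : exists2 K, 0 <= K & forall S : sys, bounded_csys T alpha M S ->
  (forall b, (hld2 (@enorm R d e') T (2 * alpha) (rem1 (sX S b) (Z S b)) <= K%:E)%E) /\
  (hld2 (@enorm R d e') T (2 * alpha) (fun s t => rem1 (sX S true) (Z S true) s t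
     - rem1 (sX S false) (Z S false) s t)%R <= (K * sD S)%:E)%E.
Proof.
have [x|K K0 HK] := @hld_bnd R d e T alpha M _ _ _ _
  (fun S b => rem1 (sX S b) (Z S b)) (2 * alpha) 2 (fun=> True)
  (@enorm_coord R d e') erefl.
  exact: (mbnd_restr (fun=> True) (mbnd_rem1_comp M T0 alpha0 HPhi) x.1 x.2).
by exists K => // S gS; exact: HK.
Qed.

Lemma hld_rem0_comp : exists2 K, 0 <= K & forall S : sys, bounded_csys T alpha M S -> geo S ->
  (forall b, (hld2 (@enorm R 1 e') T (3 * alpha) (rem0 (sX S b) (Z S b)) <= K%:E)%E) /\
  (hld2 (@enorm R 1 e') T (3 * alpha) (fun s t => rem0 (sX S true) (Z S true) s t
     - rem0 (sX S false) (Z S false) s t)%R <= (K * sD S)%:E)%E.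
Proof.
have [x|K K0 HK] := @hld_bnd R d e T alpha M _ _ _ _
  (fun S b => rem0 (sX S b) (Z S b)) (3 * alpha) 3 geo
  (@enorm_coord R 1 e') erefl.
  exact: (mbnd_rem0_comp d M T0 alpha0 HPhi x.1 x.2).
by exists K.
Qed.

Lemma controlled_comp (X : rpath R d) (Y : cpath R d e) :
  ((enorm (cp0 Y 0) + enorm (cp1 Y 0) + cnorm (cp2 Y 0))%R%:E
     + cp_norm T alpha X Y <= M%:E)%E ->
  (rp_norm T alpha X <= M%:E)%E -> geometric2 T X ->
  controlled T alpha X (cp_comp Phi Y).
Proof.
move=> HY HX geoX; have gS := bounded_csys_diag HY HX.
have [K0 _ /(_ _ gS)[/(_ true) h0 _]] := hld_incr0_comp.
have [K1 _ /(_ _ gS)/(_ true) h1] := hld_incr1_comp.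
have [K2 _ /(_ _ gS)[/(_ true) h2 _]] := hld_incr2_comp.
have [K3 _ /(_ _ gS)[/(_ true) h3 _]] := hld_rem1_comp.
have [K4 _ /(_ _ gS (fun=> geoX))[/(_ true) h4 _]] := hld_rem0_comp.
by split; [exact: le_lt_trans h0 (ltry _)|exact: le_lt_trans h1 (ltry _)|
  exact: le_lt_trans h2 (ltry _)|exact: le_lt_trans h4 (ltry _)|
  exact: le_lt_trans h3 (ltry _)].
Qed.

End Final.

Theorem proposition2p5 (R : realType) (d e e' : nat) (T alpha M : R)
    (hT : 0 < T) (halpha : 1 / 4 < alpha) (halpha' : alpha < 1 / 3)
    (Phi : 'rV[R]_e -> 'rV[R]_e') (hPhi : classC 4 Phi) :
  exists C : R, 0 < C /\
  forall (X X' : rpath R d) (Y Y' : cpath R d e),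
    rough_path T alpha X -> rough_path T alpha X' ->
    controlled T alpha X Y -> controlled T alpha X' Y' ->
    ((enorm (cp0 Y 0) + enorm (cp1 Y 0) + cnorm (cp2 Y 0))%R%:E
       + cp_norm T alpha X Y <= M%:E)%E ->
    (rp_norm T alpha X <= M%:E)%E ->
    ((enorm (cp0 Y' 0) + enorm (cp1 Y' 0) + cnorm (cp2 Y' 0))%R%:E
       + cp_norm T alpha X' Y' <= M%:E)%E ->
    (rp_norm T alpha X' <= M%:E)%E ->
    let Z := cp_comp Phi Y in
    let Z' := cp_comp Phi Y' in
    let D : \bar R := (rp_dist T alpha X X'
      + (enorm (cp0 Y 0 - cp0 Y' 0) + enorm (cp1 Y 0 - cp1 Y' 0)
         + cnorm (cp2 Y 0 - cp2 Y' 0))%R%:E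
      + cp_dist T alpha X X' Y Y')%E in
    (geometric2 T X -> geometric2 T X' ->
      [/\ controlled T alpha X Z,
          controlled T alpha X' Z' &
          (cp_dist T alpha X X' Z Z' <= C%:E * D)%E]) /\
    (hld1 (@enorm R 1 e') T alpha (fun t => (cp0 Z t - cp0 Z' t)%R)
       <= C%:E * D)%E.
Proof.
have alpha0 : 0 < alpha by lra.
have [K0 K00 H0] := @hld_incr0_comp R d e e' T alpha M hT alpha0 Phi hPhi.
have [K2 K20 H2] := @hld_incr2_comp R d e e' T alpha M hT alpha0 Phi hPhi.
have [K3 K30 H3] := @hld_rem1_comp R d e e' T alpha M hT alpha0 Phi hPhi.
have [K4 K40 H4] := @hld_rem0_comp R d e e' T alpha M hT alpha0 Phi hPhi.
(* [K2], [K4], [K3] bound the three terms of [cp_dist], [K0] bounds the seminorm of Z - Z', and 1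
   makes [C] positive. *)
pose C := K0 + (K2 + K4 + K3) + 1.
have C0 : 0 < C by rewrite ltr_pwDr// !addr_ge0.
exists C; split=> // X X' Y Y' _ _ _ _ HY HX HY' HX' Z Z' D.
(* [true] selects the data without prime, and [r] stands for a real number above [D]. *)
pose S r := CSys (fun b => if b then X else X') (fun b => if b then Y else Y') r.
have gS r : (D <= r%:E)%E -> bounded_csys T alpha M (S r).
  by move=> Dr; split=> // -[].
have D0 : (0 <= D)%E.
  have h2 := hld2_ge0 _ _ hT.
  have eg m n := @enorm_ge0 R m n; have cg d' e'' := @cnorm_ge0 R d' e''.
  have P0 (x y z : \bar R) : (0 <= x -> 0 <= y -> 0 <= z -> 0 <= x + y + z)%E.
    by move=> *; rewrite !adde_ge0.
  apply: (P0); last by apply: (P0); apply: h2.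
    by apply: (P0); apply: h2.
  by rewrite lee_fin !addr_ge0.
split=> [geoX geoX'|].
  have cc := controlled_comp hT alpha0 hPhi.
  split; [exact: cc HY HX geoX|exact: cc HY' HX' geoX'|].
  (* A finite [D] is itself taken for [r]; if [D] is +oo then so is the right-hand side, as [C] is
     positive; -oo is excluded by [D0]. *)
  move: gS D0; case: D => [r|_ _|//]; last by rewrite gt0_muley ?lte_fin// leey.
  move=> /(_ _ (lexx _)) gS; rewrite lee_fin => r0.
  have [_ h2] := H2 _ gS; have [_ h3] := H3 _ gS.
  have [|_ h4] := H4 _ gS; first by case.
  apply: le_trans (leeD (leeD h2 h4) h3) _.
  rewrite -!EFinD -EFinM lee_fin /= -!mulrDl ler_wpM2r// /C; lra.
move: gS D0; case: D => [r|_ _|//]; last by rewrite gt0_muley ?lte_fin// leey.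
move=> /(_ _ (lexx _)) gS; rewrite lee_fin => r0.
have [_ h0] := H0 _ gS; apply: le_trans h0 _.
by rewrite -EFinM lee_fin /= ler_wpM2r// /C; lra.
Qed.
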